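(* Let $(S,\mathcal S)$ be a measurable space, let $r\geq 2$, let $h\colon S^r\to\mathbb R$ be a symmetric measurable function and let $(X_i)_{i\geq 1}$ be an i.i.d. sequence of random variables with values in $S$. Suppose that $h$ is degenerated of order $i-1$ where $i\in\{2,\dots,r\}$. If there exists $\gamma>0$ such that $$M:=\sup_{t>0}\exp(t^\gamma)\,\mathbb P\left\{|h(X_1,\dots,X_r)|>t\right\}$$ is finite, then for all $x>0$ and all $N\geq r$, $$\mathbb P\left\{\max_{r\leq n\leq N}|U_n|>N^rx\right\}\leq K_1\exp\left(-K_2\,N^{\frac{i\gamma}{2+i\gamma}}\,x^{\frac{2\gamma}{2+i\gamma}}\right),$$ where $K_1$ and $K_2$ are positive constants depending on $\gamma$ and $M$ (and not on $x$ or $N$).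
   Context: For $n\geq r$, $U_n=U_{r,n}(h):=\sum_{1\leq i_1<\dots<i_r\leq n}h(X_{i_1},\dots,X_{i_r})$. The kernel $h$ is symmetric if it is invariant under all permutations of its $r$ arguments. Degeneracy: let $Y:=h(X_1,\dots,X_r)$ be integrable and let $\mathcal F_j$ be the $\sigma$-algebra generated by $X_1,\dots,X_j$. For $i\in\{2,\dots,r\}$, $h$ is degenerated of order $i-1$ if $\mathbb E[Y\mid\mathcal F_{i-1}]=0$ almost surely but $\mathbb E[Y\mid\mathcal F_i]$ is not almost surely equal to zero. *)

(* Defs.v *)
From HB Require Import structures.
From mathcomp Require Import all_boot all_order all_fingroup all_algebra finmap.
From mathcomp Require Import all_classical all_reals all_analysis.

Set Implicit Arguments.
Unset Strict Implicit.
Unset Printing Implicit Defensive.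

Import Order.TTheory GRing.Theory Num.Theory.
Import numFieldNormedType.Exports.

Local Open Scope classical_set_scope.
Local Open Scope ring_scope.

(* Random variables X_1, X_2, ... are indexed from 0: X_k is [X k.-1]. *)

Definition mutually_independent d d' (T : measurableType d)
    (S : measurableType d') (R : realType) (P : probability T R)
    (X : nat -> T -> S) : Prop :=
  forall (J : {fset nat}) (A : nat -> set S),
    (forall k, measurable (A k)) ->
    P (\bigcap_(k in [set` J]) X k @^-1` A k) =
    (\prod_(k <- J) P (X k @^-1` A k))%E.

Definition identically_distributed d d' (T : measurableType d)
    (S : measurableType d') (R : realType) (P : probability T R)
    (X : nat -> T -> S) : Prop :=
  forall (k : nat) (A : set S), measurable A ->
    P (X k @^-1` A) = P (X 0%N @^-1` A).

Definition iid d d' (T : measurableType d) (S : measurableType d')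
    (R : realType) (P : probability T R) (X : nat -> T -> S) : Prop :=
  mutually_independent P X /\ identically_distributed P X.

Definition symmetric_kernel (S R : Type) (r : nat) (h : r.-tuple S -> R)
  : Prop :=
  forall (s : 'S_r) (x : r.-tuple S), h [tuple tnth x (s k) | k < r] = h x.

(* The indices i_1 < ... < i_r are the entries of the increasing tuple [s]. *)
Definition Ustat (T S : Type) (R : realType) (r : nat) (h : r.-tuple S -> R)
    (X : nat -> T -> S) (n : nat) (w : T) : R :=
  \sum_(s : r.-tuple 'I_n | sorted ltn (map val s))
    h [tuple X (tnth s k) w | k < r].

Definition first_value (T S R : Type) (r : nat) (h : r.-tuple S -> R)
    (X : nat -> T -> S) (w : T) : R :=
  h [tuple X k w | k < r].

(* [cond_exp_version P G Y Z]: [Z] is a version of E[Y | G], for a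
   sub-sigma-algebra [G] of the measurable sets and an integrable [Y]. *)
Definition cond_exp_version d (T : measurableType d) (R : realType)
    (P : probability T R) (G : set (set T)) (Y Z : T -> R) : Prop :=
  [/\ forall B : set R, measurable B -> G (Z @^-1` B),
      P.-integrable setT (EFin \o Z) &
      forall A, G A ->
        (\int[P]_(w in A) (Z w)%:E = \int[P]_(w in A) (Y w)%:E)%E].

(* The sigma-algebra generated by the first [j] variables. *)
Definition filtration_of d' (T : Type) (S : measurableType d')
    (X : nat -> T -> S) (j : nat) : set (set T) :=
  g_sigma_preimage (fun k : 'I_j => X k).

(* Any two versions of a conditional expectation agree almost surely, so that
   quantifying existentially over the version is innocuous. *)
Definition degenerate_order d d' (T : measurableType d)
    (S : measurableType d') (R : realType) (P : probability T R) (r : nat)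
    (h : r.-tuple S -> R) (X : nat -> T -> S) (j : nat) : Prop :=
  let Y := first_value h X in
  [/\ P.-integrable setT (EFin \o Y),
      exists2 Z, cond_exp_version P (filtration_of X j) Y Z &
        {ae P, forall w, Z w = 0} &
      exists2 Z, cond_exp_version P (filtration_of X j.+1) Y Z &
        ~ {ae P, forall w, Z w = 0}].

Definition exp_tail_sup d (T : measurableType d) (R : realType)
    (P : probability T R) (gamma : R) (Y : T -> R) : \bar R :=
  ereal_sup [set ((expR (t `^ gamma)%R)%:E * P [set w | (t < `|Y w|)%R])%E
            | t in [set t : R | 0 < t]].

(* Main.v *)
(* Let h_A be the conditional expectation of h given the variables with index in
   A, and g_J = sum_(A c J) (-1)^|J \ A| h_A its Hoeffding components.  By Moebius
   inversion U_n = sum_j 'C(n - j, r - j) V_n^j with V_n^j the sum of the g_J over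
   |J| = j, and degeneracy of order i - 1 kills the terms with j < i.  Each V^j is
   a martingale, so Doob's inequality reduces its maximum to ||V_N^j||_(2q).
   Iterating (s + d)^(2q) <= 2 q s^(2q-1) d + (s^2 + 24 q d^2)^q, in which the
   linear term has mean zero, coordinate by coordinate gives
     ||V_N^j||_(2q)^2 <= 'C(N, j) (24 q)^j 4^j ||h||_(2q)^2,
   while trivially ||V_N^j||_(2q)^2 <= 'C(N, j)^2 4^j ||h||_(2q)^2.  The first
   bound for q <= N and the second for q > N yield, for j >= i,
     ||V_N^j||_(2q)^2 <= 96^j / j! N^(2j - i) q^i ||h||_(2q)^2,
   and j! makes the sum over j converge uniformly in r.  The tail assumption gives
   ||h||_(2q)^2 <= C q^(2/gamma), hence a bound (D q^(i + 2/gamma) / (N^i x^2))^q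
   for the probability; optimize in q. *)

Require Import Defs.
From HB Require Import structures.
From mathcomp Require Import all_boot all_order all_fingroup all_algebra finmap.
From mathcomp Require Import all_classical all_reals all_analysis.
From mathcomp Require Import measurable_realfun.
From mathcomp Require Import zify ring lra.

Set Implicit Arguments.
Unset Strict Implicit.
Unset Printing Implicit Defensive.

Import Order.TTheory GRing.Theory Num.Theory.
Import numFieldNormedType.Exports.

Local Open Scope classical_set_scope.
Local Open Scope ring_scope.

(** * Elementary inequalities *)

Lemma bernoulli_ge (R : realFieldType) (u : R) (n : nat) :
  -1 <= u -> 1 + n%:R * u <= (1 + u) ^+ n.
Proof.
move=> u1; elim: n => [|n IH]; first by rewrite mul0r addr0 expr0.
rewrite exprS -natr1; have u0 : 0 <= 1 + u by lra.
apply: le_trans (ler_wpM2l u0 IH).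
have : 0 <= n%:R * u ^+ 2 by rewrite mulr_ge0 ?sqr_ge0.
by lra.
Qed.

Lemma expr_dbl (R : comRingType) (x : R) (q : nat) : x ^+ q.*2 = (x ^+ 2) ^+ q.
Proof. by rewrite -mul2n exprM. Qed.

Lemma expr_dbl_ge0 (R : realDomainType) (x : R) (q : nat) : 0 <= x ^+ q.*2.
Proof. by rewrite expr_dbl exprn_ge0// sqr_ge0. Qed.

Lemma expr_dbl_homog (R : fieldType) (s d : R) (q : nat) :
  (0 < q)%N -> s != 0 -> s ^+ q.*2.-1 * d = s ^+ q.*2 * (d / s).
Proof.
case: q => // q _ s0; rewrite doubleS /= [s ^+ q.*2.+2]exprS.
by field.
Qed.

Lemma even_power_tangent (R : realFieldType) (s d : R) (q : nat) :
  (0 < q)%N -> s ^+ q.*2 + q.*2%:R * (s ^+ q.*2.-1 * d) <= (s + d) ^+ q.*2.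
Proof.
move=> q0; have [->|s0] := eqVneq s 0.
  case: q q0 => // q _; rewrite doubleS /= !expr0n /= mul0r mulr0 !add0r.
  by rewrite -doubleS expr_dbl_ge0.
rewrite expr_dbl_homog// [X in _ <= X ^+ _](_ : _ = s * (1 + d / s)); last first.
  by field.
rewrite exprMn mulrCA -{1}[s ^+ _]mulr1 -mulrDr ler_wpM2l ?expr_dbl_ge0//.
set t := d / s; rewrite expr_dbl.
rewrite (_ : (1 + t) ^+ 2 = 1 + (2 * t + t ^+ 2)); last by ring.
apply: le_trans (bernoulli_ge _ _).
  rewrite -mul2n natrM; have : 0 <= q%:R * t ^+ 2 by rewrite mulr_ge0 ?sqr_ge0.
  by lra.
by have := sqr_ge0 (1 + t); lra.
Qed.

Lemma even_power_centered_unit (R : realFieldType) (t : R) (q m : nat) :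
  (0 < q)%N -> (m <= q)%N ->
  (1 + t) ^+ m.*2 <= m.*2%:R * t + (1 + 24 * q%:R * t ^+ 2) ^+ m.
Proof.
move=> q0; elim: m => [|m IH] mq; first by rewrite !expr0 mul0r add0r.
have {}IH := IH (ltnW mq).
set Q := q%:R in IH *; set a := 24 * Q in IH *; set W := (_ ^+ m) in IH.
have Q1 : 1 <= Q by rewrite ler1n.
have MQ : m%:R + 1 <= Q by rewrite natr1 ler_nat.
have M0 : 0 <= m%:R :> R by [].
have t2 : 0 <= t ^+ 2 by exact: sqr_ge0.
have at0 : 0 <= a * t ^+ 2 by rewrite mulr_ge0// mulr_ge0.
have W1 : 1 + m%:R * (a * t ^+ 2) <= W by apply: bernoulli_ge; lra.
have W2 : W * (1 - m%:R * (a * t ^+ 2)) <= 1.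
  rewrite /W; elim: (m) => [|k IHk]; first by rewrite expr0 mul0r subr0 mulr1.
  set u := a * t ^+ 2 in at0 IHk *.
  apply: le_trans IHk; rewrite exprSr -mulrA ler_wpM2l ?exprn_ge0//; first lra.
  have : 0 <= k%:R * u ^+ 2 by rewrite mulr_ge0 ?sqr_ge0.
  by rewrite -natr1; have := sqr_ge0 u; lra.
rewrite doubleS -addn2 exprD.
apply: le_trans (ler_wpM2r (sqr_ge0 _) IH) _.
rewrite [X in _ <= _ + X]exprS -/W natrD -mul2n natrM.
set M := m%:R in MQ M0 W1 W2 *.
have WW : 1 <= W by rewrite (le_trans _ W1)// lerDl mulr_ge0.
suff: 2 * t * (W - 1) + 4 * M * t ^+ 2 + 2 * M * t ^+ 3 <= (a - 1) * t ^+ 2 * W by lra.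
have tW : t ^+ 2 <= t ^+ 2 * W by rewrite ler_peMr.
have MtW : M * t ^+ 2 <= Q * (t ^+ 2 * W).
  by rewrite ler_pM//; lra.
have aE : (a - 1) * t ^+ 2 * W = 24 * (Q * (t ^+ 2 * W)) - t ^+ 2 * W by rewrite /a; ring.
have tQ : t ^+ 2 * W <= Q * (t ^+ 2 * W) by rewrite ler_peMl// mulr_ge0//; lra.
have [t0|t0] := leP t 0.
  have : 2 * t * (W - 1) <= 0 by rewrite mulr_le0_ge0//; lra.
  have : 2 * M * t ^+ 3 <= 0.
    by rewrite mulr_ge0_le0//; [lra | rewrite exprSr mulr_ge0_le0].
  by lra.
have MtW' : M * t ^+ 4 <= t ^+ 2 * W.
  have -> : M * t ^+ 4 = t ^+ 2 * (M * t ^+ 2) by ring.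
  rewrite ler_wpM2l// (le_trans _ W1)//.
  have : 0 <= M * t ^+ 2 by rewrite mulr_ge0.
  have : 0 <= M * t ^+ 2 * (Q - 1) by rewrite !mulr_ge0//; lra.
  by rewrite /a; lra.
have c3 : 2 * M * t ^+ 3 <= M * t ^+ 2 + M * t ^+ 4.
  have : 0 <= M * t ^+ 2 * (1 - t) ^+ 2 by rewrite mulr_ge0 ?sqr_ge0// mulr_ge0.
  by lra.
suff : 2 * t * (W - 1) <= 17 * (Q * (t ^+ 2 * W)) by lra.
have -> : 2 * t * (W - 1) = t * (2 * (W - 1)) by ring.
have -> : 17 * (Q * (t ^+ 2 * W)) = t * (17 * (Q * t) * W) by ring.
apply: ler_wpM2l; first exact: ltW.
have [z|z] := leP 2 (17 * (Q * t)).
  apply: (@le_trans _ _ (2 * W)); first lra.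
  by rewrite ler_wpM2r//; lra.
have z0 : 0 <= Q * t by apply: mulr_ge0; lra.
apply: (@le_trans _ _ (2 * (M * (a * t ^+ 2)) * W)); first lra.
rewrite ler_wpM2r//; first lra.
have : M * (a * t ^+ 2) <= Q * (a * t ^+ 2) by rewrite ler_wpM2r//; lra.
have -> : Q * (a * t ^+ 2) = 24 * ((Q * t) * (Q * t)) by rewrite /a; ring.
have : (Q * t) * (17 * (Q * t)) <= (Q * t) * 2.
  by apply: ler_wpM2l => //; exact: ltW.
by lra.
Qed.

Lemma even_power_centered (R : realFieldType) (s d : R) (q : nat) :
  (0 < q)%N ->
  (s + d) ^+ q.*2 <= q.*2%:R * (s ^+ q.*2.-1 * d)
                     + (s ^+ 2 + 24 * q%:R * d ^+ 2) ^+ q.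
Proof.
move=> q0; have [->|s0] := eqVneq s 0.
  case: q q0 => // q _.
  rewrite doubleS /= [_ ^+ _.+1 * d](_ : _ = 0); last by rewrite exprS !mul0r.
  rewrite mulr0 !add0r (_ : 0 ^+ 2 = 0) ?expr0n// add0r -doubleS expr_dbl.
  have d0 : 0 <= d ^+ 2 by exact: sqr_ge0.
  have q1 : 1 <= q.+1%:R :> R by rewrite ler1n.
  have dq : d ^+ 2 <= 24 * q.+1%:R * d ^+ 2 by rewrite ler_peMl//; lra.
  by rewrite lerXn2r ?nnegrE // (le_trans d0).
rewrite expr_dbl_homog// [X in X ^+ _ <= _](_ : _ = s * (1 + d / s)); last first.
  by field.
rewrite [X in _ <= _ + X ^+ _](_ : _ = s ^+ 2 * (1 + 24 * q%:R * (d / s) ^+ 2));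
  last by field.
set t := d / s.
rewrite (exprMn q.*2 s) (exprMn q (s ^+ 2)) -(expr_dbl s) mulrCA -mulrDr.
by rewrite ler_wpM2l ?expr_dbl_ge0//; exact: even_power_centered_unit.
Qed.

Lemma convex_power (R : realFieldType) (x y p q : R) (n : nat) :
  0 <= x -> 0 <= y -> 0 <= p -> 0 <= q -> p + q = 1 ->
  (p * x + q * y) ^+ n <= p * x ^+ n + q * y ^+ n.
Proof.
move=> x0 y0 p0 q0 pq; elim: n => [|n IH]; first by rewrite !expr0; lra.
rewrite exprS; apply: le_trans (ler_wpM2l _ IH) _; first by rewrite addr_ge0// mulr_ge0.
suff : 0 <= p * q * ((x - y) * (x ^+ n - y ^+ n)).
  rewrite !exprS; have -> : q = 1 - p by lra.
  by lra.
apply: mulr_ge0; first exact: mulr_ge0.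
have [xy|xy] := leP x y.
  by rewrite mulr_le0// subr_le0// lerXn2r ?nnegrE.
by rewrite mulr_ge0// subr_ge0// ?lerXn2r ?nnegrE// ltW.
Qed.

Lemma minkowski_pointwise (R : realFieldType) (x y a b : R) (n : nat) :
  0 <= x -> 0 <= y -> 0 < a -> 0 < b ->
  (x + y) ^+ n <= (a + b) ^+ n *
    (a / (a + b) * (x ^+ n / a ^+ n) + b / (a + b) * (y ^+ n / b ^+ n)).
Proof.
move=> x0 y0 a0 b0; have ab : a + b != 0 by rewrite lt0r_neq0// addr_gt0.
have [an bn] := (lt0r_neq0 a0, lt0r_neq0 b0).
have -> : x + y = (a + b) * (a / (a + b) * (x / a) + b / (a + b) * (y / b)).
  by field; rewrite ab an bn.
rewrite exprMn -!expr_div_n ler_wpM2l ?exprn_ge0//; first lra.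
apply: convex_power; rewrite ?divr_ge0//; try lra.
by field.
Qed.

(** * Random variables with moments of all orders *)

Section moments.
Context d (T : measurableType d) (R : realType) (P : probability T R).
Implicit Types f g : T -> R.

Definition has_moments f := measurable_fun setT f /\
  forall m, P.-integrable setT (EFin \o (fun w => f w ^+ m)).

Lemma normr_expr_le (x : R) (m : nat) : `|x| ^+ m <= 1 + x ^+ m.*2.
Proof.
have x0 : 0 <= `|x| ^+ m by rewrite exprn_ge0.
rewrite -mul2n mulnC exprM -[X in _ <= 1 + X]real_normK ?num_real// normrX.
by have := sqr_ge0 (`|x| ^+ m - 1); lra.
Qed.

Lemma integrable_dominated f g : measurable_fun setT f ->
  (forall w, `|f w| <= g w) -> P.-integrable setT (EFin \o g) ->
  P.-integrable setT (EFin \o f).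
Proof.
move=> mf fg; apply: le_integrable => //; first exact/measurable_EFinP.
by move=> w _ /=; rewrite lee_fin (le_trans (fg w))// ler_norm.
Qed.

Lemma has_moments_int f : has_moments f -> P.-integrable setT (EFin \o f).
Proof. by move=> [_ /(_ 1%N)]. Qed.

Lemma has_moments_dominated f : measurable_fun setT f ->
  (forall m, exists2 g : T -> R, P.-integrable setT (EFin \o g) &
    forall w, f w ^+ m.*2 <= g w) -> has_moments f.
Proof.
move=> mf H; split => // m; have [g ig fg] := H m.
apply: (@integrable_dominated _ (fun w => 1 + g w)).
- exact: measurable_funX.
- by move=> w; rewrite normrX (le_trans (normr_expr_le _ _))// lerD2l.
- rewrite (_ : EFin \o _ = (EFin \o cst 1%R) \+ (EFin \o g)) //.
  by apply: integrableD => //; exact: finite_measure_integrable_cst.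
Qed.

Lemma has_moments_bounded f (c : R) : measurable_fun setT f ->
  (forall w, `|f w| <= c) -> has_moments f.
Proof.
move=> mf fc; apply: has_moments_dominated => // m.
exists (fun=> c ^+ m.*2); first exact: finite_measure_integrable_cst.
move=> w; rewrite -[X in X <= _]ger0_norm ?expr_dbl_ge0// normrX lerXn2r//.
by rewrite nnegrE (le_trans _ (fc w)).
Qed.

Lemma has_moments_cst (c : R) : has_moments (cst c).
Proof. exact: (@has_moments_bounded _ `|c|). Qed.

Lemma has_moments_exp f n : has_moments f -> has_moments (fun w => f w ^+ n).
Proof.
move=> [mf fi]; split; first exact: measurable_funX.
by move=> m; under eq_fun do rewrite -exprM; exact: fi.
Qed.

Lemma has_moments_mul f g : has_moments f -> has_moments g ->
  has_moments (fun w => f w * g w).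
Proof.
move=> [mf fi] [mg gi]; apply: has_moments_dominated; first exact: measurable_funM.
move=> m; exists (fun w => f w ^+ m.*2.*2 + g w ^+ m.*2.*2).
  by apply: (integrableD _ (fi _) (gi _)).
have E (x : R) : x ^+ m.*2.*2 = (x ^+ m.*2) ^+ 2 by rewrite -exprM muln2.
have H (x y : R) : x * y <= x ^+ 2 + y ^+ 2.
  have := sqr_ge0 (x - y); have := sqr_ge0 x; have := sqr_ge0 y.
  by lra.
by move=> w; rewrite exprMn !E; exact: H.
Qed.

Lemma has_moments_scale (c : R) f : has_moments f ->
  has_moments (fun w => c * f w).
Proof. by move=> mf; apply: has_moments_mul => //; exact: has_moments_cst. Qed.

Lemma has_moments_add f g : has_moments f -> has_moments g ->
  has_moments (fun w => f w + g w).
Proof.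
move=> [mf fi] [mg gi]; apply: has_moments_dominated; first exact: measurable_funD.
move=> m; exists (fun w => 2 ^+ m.*2 * (f w ^+ m.*2 + g w ^+ m.*2)).
  have := integrableZl measurableT (2 ^+ m.*2) (integrableD measurableT (fi m.*2) (gi m.*2)).
  exact.
move=> w; rewrite -[X in X <= _]ger0_norm ?expr_dbl_ge0// normrX.
apply: (@le_trans _ _ ((`|f w| + `|g w|) ^+ m.*2)).
  by rewrite lerXn2r ?nnegrE ?addr_ge0// ler_normD.
rewrite -[X in _ <= _ * (X + _)]ger0_norm ?expr_dbl_ge0//.
rewrite -[X in _ <= _ * (_ + X)]ger0_norm ?expr_dbl_ge0// !normrX.
apply: le_trans (minkowski_pointwise _ (normr_ge0 _) (normr_ge0 _) ltr01 ltr01) _.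
rewrite ler_wpM2l// !expr1n.
have H (x y : R) : 0 <= x -> 0 <= y ->
  1 / (1 + 1) * (x / 1) + 1 / (1 + 1) * (y / 1) <= x + y.
  by move=> x0 y0; rewrite !divr1 (_ : 1 + 1 = 2 :> R)//; lra.
by apply: H; exact: exprn_ge0.
Qed.

Lemma has_moments_opp f : has_moments f -> has_moments (fun w => - f w).
Proof.
by move=> /(has_moments_scale (-1)); under eq_fun do rewrite mulN1r.
Qed.

Lemma has_moments_sum I (s : seq I) (Q : pred I) (g : I -> T -> R) :
  (forall i, Q i -> has_moments (g i)) ->
  has_moments (fun w => \sum_(i <- s | Q i) g i w).
Proof.
move=> H; elim: s => [|i s IH].
  by under eq_fun do rewrite big_nil; exact: has_moments_cst.
under eq_fun do rewrite big_cons.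
have [Qi|//] := boolP (Q i).
by apply: has_moments_add => //; exact: H.
Qed.

Lemma Rintegral_ler f g : has_moments f -> has_moments g ->
  (forall w, f w <= g w) -> \int[P]_w f w <= \int[P]_w g w.
Proof.
by move=> mf mg fg; apply: le_Rintegral => //; exact: has_moments_int.
Qed.

Lemma RintegralDm f g : has_moments f -> has_moments g ->
  \int[P]_w (f w + g w) = \int[P]_w f w + \int[P]_w g w.
Proof. by move=> mf mg; apply: RintegralD => //; exact: has_moments_int. Qed.

Lemma RintegralZm (c : R) f : has_moments f ->
  \int[P]_w (c * f w) = c * \int[P]_w f w.
Proof. by move=> mf; apply: RintegralZl => //; exact: has_moments_int. Qed.

Lemma Rintegral_cst1 (c : R) : \int[P]_w (cst c w) = c.
Proof. by rewrite Rintegral_cst//= probability_setT mulr1. Qed.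

Lemma Rintegral_summ I (s : seq I) (Q : pred I) (g : I -> T -> R) :
  (forall i, Q i -> has_moments (g i)) ->
  \int[P]_w (\sum_(i <- s | Q i) g i w) = \sum_(i <- s | Q i) \int[P]_w g i w.
Proof.
move=> H; elim: s => [|i s IH].
  rewrite big_nil; under eq_Rintegral do rewrite big_nil.
  exact: (Rintegral_cst1 0).
rewrite big_cons; under eq_Rintegral do rewrite big_cons.
have [Qi|//] := boolP (Q i); rewrite RintegralDm ?IH//; first exact: H.
exact: has_moments_sum.
Qed.

Lemma expr_add_small (c e : R) n : 0 <= c -> 0 <= e <= 1 ->
  (c + e) ^+ n <= c ^+ n + e * (c + 2) ^+ n.
Proof.
move=> c0 /andP[e0 e1]; elim: n => [|n IH]; first by rewrite !expr0; lra.
rewrite !exprS; apply: le_trans (ler_wpM2l _ IH) _; first lra.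
have cn : c ^+ n <= (c + 2) ^+ n by rewrite lerXn2r ?nnegrE//; lra.
have c2 : 0 <= e * (c + 2) ^+ n by rewrite mulr_ge0 ?exprn_ge0//; lra.
have : e * (e * (c + 2) ^+ n) <= 1 * (e * (c + 2) ^+ n) by rewrite ler_wpM2r.
have : e * c ^+ n <= e * (c + 2) ^+ n by rewrite ler_wpM2l.
by lra.
Qed.

Lemma Rintegral_minkowski f g (a b : R) n :
  has_moments f -> has_moments g -> (forall w, 0 <= f w) -> (forall w, 0 <= g w) ->
  0 <= a -> 0 <= b -> \int[P]_w (f w ^+ n) <= a ^+ n ->
  \int[P]_w (g w ^+ n) <= b ^+ n -> \int[P]_w ((f w + g w) ^+ n) <= (a + b) ^+ n.
Proof.
move=> mf mg f0 g0; have eqle (x y : R) : x = y -> x <= y by move=> ->.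
have pos (u v : R) : 0 < u -> 0 < v -> \int[P]_w (f w ^+ n) <= u ^+ n ->
  \int[P]_w (g w ^+ n) <= v ^+ n -> \int[P]_w ((f w + g w) ^+ n) <= (u + v) ^+ n.
  move=> u0 v0 fu gv.
  pose A := (u + v) ^+ n * (u / (u + v) / u ^+ n).
  pose B := (u + v) ^+ n * (v / (u + v) / v ^+ n).
  have uv0 : 0 < u + v by rewrite addr_gt0.
  have A0 : 0 <= A by rewrite mulr_ge0 ?exprn_ge0 ?divr_ge0 ?exprn_ge0 ?ltW.
  have B0 : 0 <= B by rewrite mulr_ge0 ?exprn_ge0 ?divr_ge0 ?exprn_ge0 ?ltW.
  apply: (@le_trans _ _ (\int[P]_w (A * f w ^+ n + B * g w ^+ n))).
    apply: Rintegral_ler.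
    - exact/has_moments_exp/has_moments_add.
    - by apply: has_moments_add; apply/has_moments_scale/has_moments_exp.
    - move=> w; apply: le_trans (minkowski_pointwise _ (f0 w) (g0 w) u0 v0) _.
      by apply: eqle; rewrite /A /B; ring.
  rewrite RintegralDm ?RintegralZm; try by do ?[apply: has_moments_scale|exact: has_moments_exp].
  apply: (@le_trans _ _ (A * u ^+ n + B * v ^+ n)).
    by rewrite lerD// ler_wpM2l.
  apply: eqle; rewrite /A /B; field.
  by rewrite !expf_neq0 ?lt0r_neq0.
move=> a0 b0 fa gb; apply/ler_addgt0Pr => e e0.
pose K := (a + b + 2) ^+ n.
have K0 : 0 < K by rewrite exprn_gt0//; lra.
pose t := Num.min 1 (e / K).
have t0 : 0 < t by rewrite lt_min ltr01 divr_gt0.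
have t1 : t <= 1 by rewrite ge_min lexx.
have tK : t * K <= e by rewrite -ler_pdivlMr// ge_min lexx orbT.
apply: (@le_trans _ _ ((a + t / 2 + (b + t / 2)) ^+ n)).
  apply: pos; [lra|lra| |].
  - by apply: le_trans fa _; rewrite lerXn2r ?nnegrE//; lra.
  - by apply: le_trans gb _; rewrite lerXn2r ?nnegrE//; lra.
rewrite (_ : a + _ + _ = a + b + t); last by lra.
apply: le_trans (expr_add_small _ _ _) _; [lra|lra|].
by rewrite lerD2l.
Qed.

Lemma Rintegral_sum_power I (s : seq I) (g : I -> T -> R) (c : R) n :
  0 <= c -> (0 < n)%N -> (forall i, has_moments (g i)) ->
  (forall i w, 0 <= g i w) ->
  (forall i, \int[P]_w (g i w ^+ n) <= c ^+ n) ->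
  \int[P]_w ((\sum_(i <- s) g i w) ^+ n) <= ((size s)%:R * c) ^+ n.
Proof.
move=> c0 n0 mg g0 gc; elim: s => [|i s IH].
  under eq_Rintegral do rewrite big_nil.
  by rewrite (Rintegral_cst1 (0 ^+ n)) mul0r.
under eq_Rintegral do rewrite big_cons.
rewrite /= -natr1 mulrDl mul1r addrC.
apply: Rintegral_minkowski => //.
- exact: has_moments_sum.
- by move=> w; exact: sumr_ge0.
- by rewrite mulr_ge0.
Qed.

End moments.

(** * Orthogonal families: moment and maximal inequalities *)

Lemma measurable_natr_bool d (T : measurableType d) (R : realType) (b : T -> bool) :
  measurable_fun setT b -> measurable_fun setT (fun w => (b w)%:R : R).
Proof.
move=> mb; rewrite (_ : (fun w => _) = (fun w => if b w then 1 else 0)).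
  by apply: measurable_fun_ifT.
by apply/funext => w; case: (b w).
Qed.

Section orthogonal_families.
Context d (T : measurableType d) (R : realType) (P : probability T R).
Variables (N : nat) (C : nat -> set (set T)) (g : {set 'I_N} -> T -> R).

(* [insensitive k phi]: in the application [C k] generates the sigma-algebra of
   all variables but the k-th, so that [phi] does not depend on the latter. *)
Definition insensitive (k : nat) (phi : T -> R) :=
  measurable_fun (setT : set (g_sigma_algebraType (C k))) phi.

Hypothesis g_moments : forall J, has_moments P (g J).
Hypothesis g_insensitive :
  forall (J : {set 'I_N}) (k : 'I_N), k \notin J -> insensitive k (g J).
Hypothesis g_orthogonal : forall (J : {set 'I_N}) (k : 'I_N) phi, k \in J ->
  insensitive k phi -> has_moments P phi -> \int[P]_w (phi w * g J w) = 0.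

Lemma insensitive_sum (k : nat) I (s : seq I) (Q : pred I) (f : I -> T -> R) :
  (forall i, Q i -> insensitive k (f i)) ->
  insensitive k (fun w => \sum_(i <- s | Q i) f i w).
Proof.
move=> H; elim: s => [|i s IH].
  by under eq_fun do rewrite big_nil; exact: measurable_cst.
under eq_fun do rewrite big_cons; rewrite /insensitive.
have [Qi|_] := boolP (Q i); last exact: IH.
by apply: measurable_funD => //; exact: H.
Qed.

Lemma orthogonal_sum (k : 'I_N) (F : pred {set 'I_N}) phi :
  (forall J, F J -> k \in J) -> insensitive k phi -> has_moments P phi ->
  \int[P]_w (phi w * \sum_(J | F J) g J w) = 0.
Proof.
move=> Fk iphi mphi; under eq_Rintegral do rewrite mulr_sumr.
rewrite Rintegral_summ => [|J _]; last exact: has_moments_mul.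
by apply: big1 => J FJ; apply: (@g_orthogonal J k) => //; exact: Fk.
Qed.

Definition agree_from (k : nat) (A J : {set 'I_N}) :=
  [forall i : 'I_N, (k <= i)%N ==> ((i \in J) == (i \in A))].

Lemma agree_fromS (k : 'I_N) (A J : {set 'I_N}) :
  agree_from k A J = agree_from k.+1 A J && ((k \in J) == (k \in A)).
Proof.
apply/forallP/andP => [H|[/forallP H kJA] i].
  split; last by have := H k; rewrite leqnn.
  by apply/forallP => i; apply/implyP => ki; have := H i; rewrite (ltnW ki).
apply/implyP; rewrite leq_eqVlt => /predU1P[ki|ki].
  by rewrite (_ : i = k)//; apply/val_inj.
by have := H i; rewrite ki.
Qed.

Lemma agree_from_eq (k : nat) (A B J : {set 'I_N}) :
  (forall i : 'I_N, (k <= i)%N -> (i \in A) = (i \in B)) ->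
  agree_from k A J = agree_from k B J.
Proof.
move=> AB; apply: eq_forallb => i.
by case: (leqP k i) => //= ki; rewrite AB.
Qed.

Let below (k : nat) : {set 'I_N} := [set i : 'I_N | (i < k)%N]%SET.

(* Induction on the coordinates: in [U + V], with [U] the terms not containing
   the coordinate [k] and [V] the others, [V] is orthogonal to all functions of
   [U], so that ||U + V||^2 <= ||U||^2 + 24 q ||V||^2 in L^(2q). *)
Lemma even_moment_sum_agree (q : nat) (G : R) (F : pred {set 'I_N}) :
  (0 < q)%N -> 0 <= G -> (forall J, F J -> \int[P]_w (g J w ^+ q.*2) <= G ^+ q) ->
  forall k (A : {set 'I_N}), (k <= N)%N ->
  \int[P]_w ((\sum_(J | F J && agree_from k A J) g J w) ^+ q.*2) <=
  ((\sum_(J | F J && agree_from k A J) (24 * q%:R) ^+ #|J :&: below k|) * G) ^+ q.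
Proof.
move=> q0 G0 gG; elim=> [|k IH] A kN.
  have agE J : agree_from 0 A J = (J == A).
    apply/forallP/eqP => [H|-> i]; last by rewrite eqxx implybT.
    by apply/setP => i; apply/eqP; have := H i.
  have [FA|nFA] := boolP (F A).
    have E (S : nmodType) (f : {set 'I_N} -> S) :
        \sum_(J | F J && agree_from 0 A J) f J = f A.
      rewrite (eq_bigl (pred1 A)) ?big_pred1_eq// => J.
      by rewrite /= agE; case: eqP => [->|]; rewrite ?FA ?andbF.
    under eq_Rintegral do rewrite E.
    rewrite E (_ : _ :&: _ = finset.set0) ?cards0 ?expr0 ?mul1r; first exact: gG.
    by apply/setP => i; rewrite !inE andbF.
  have E (S : nmodType) (f : {set 'I_N} -> S) :
      \sum_(J | F J && agree_from 0 A J) f J = 0.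
    rewrite big_pred0// => J; rewrite agE.
    by case: eqP => [->|]; rewrite ?(negbTE nFA) ?andbF.
  under eq_Rintegral do rewrite E.
  rewrite E mul0r !expr0n double_eq0 (gtn_eqF q0).
  by rewrite (_ : Rintegral _ _ _ = 0)//; exact: (Rintegral_cst1 P 0).
pose k' := Ordinal kN.
pose A0 := A :\ k'; pose A1 := k' |: A.
have AE0 J : (F J && agree_from k.+1 A J) && (k' \notin J) = F J && agree_from k A0 J.
  rewrite -andbA (agree_fromS k') /= !inE eqxx /= eqbF_neg; congr (_ && (_ && _)).
  apply: agree_from_eq => i ki; rewrite !inE (_ : i == k' = false)//.
  by apply/eqP => ik; rewrite ik /= ltnn in ki.
have AE1 J : (F J && agree_from k.+1 A J) && (k' \in J) = F J && agree_from k A1 J.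
  rewrite -andbA (agree_fromS k') /= !inE eqxx /= eqb_id; congr (_ && (_ && _)).
  apply: agree_from_eq => i ki; rewrite !inE (_ : i == k' = false)//.
  by apply/eqP => ik; rewrite ik /= ltnn in ki.
have split (S : nmodType) (f : {set 'I_N} -> S) :
    \sum_(J | F J && agree_from k.+1 A J) f J =
    \sum_(J | F J && agree_from k A0 J) f J + \sum_(J | F J && agree_from k A1 J) f J.
  rewrite (bigID (fun J : {set 'I_N} => k' \notin J)) /=; congr (_ + _).
    by apply: eq_bigl => J; rewrite AE0.
  by apply: eq_bigl => J; rewrite negbK AE1.
have below0 (J : {set 'I_N}) : k' \notin J -> J :&: below k.+1 = J :&: below k.
  move=> kJ; apply/setP => i; rewrite !inE ltnS leq_eqVlt.
  have [ik|//] := eqVneq (i : nat) k; rewrite (_ : i = k') ?(negbTE kJ)//.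
  exact/val_inj.
have below1 (J : {set 'I_N}) : k' \in J -> #|J :&: below k.+1| = #|J :&: below k|.+1.
  move=> kJ; rewrite (_ : J :&: below k.+1 = k' |: (J :&: below k)).
    by rewrite cardsU1 !inE ltnn andbF.
  apply/setP => i; rewrite !inE ltnS leq_eqVlt -val_eqE /=.
  by have [ik|//] := eqVneq (i : nat) k; rewrite (_ : i = k') ?kJ//; exact/val_inj.
pose U w := \sum_(J | F J && agree_from k A0 J) g J w.
pose V w := \sum_(J | F J && agree_from k A1 J) g J w.
have mU : has_moments P U by apply: has_moments_sum.
have mV : has_moments P V by apply: has_moments_sum.
under eq_Rintegral do rewrite split -/(U _) -/(V _).
rewrite split.
set a := 24 * q%:R in IH *.
have a0 : 0 <= a by rewrite mulr_ge0.
pose wt A := \sum_(J | F J && agree_from k A J) a ^+ #|J :&: below k|.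
have wt_ge0 B : 0 <= wt B by apply: sumr_ge0 => J _; rewrite exprn_ge0.
rewrite [X in (X + _) * G](_ : _ = wt A0); last first.
  by apply: eq_bigr => J; rewrite -AE0 => /andP[_ kJ]; rewrite below0.
rewrite [X in (_ + X) * G](_ : _ = a * wt A1); last first.
  rewrite mulr_sumr; apply: eq_bigr => J; rewrite -AE1 => /andP[_ kJ].
  by rewrite below1// exprS.
apply: (@le_trans _ _ (\int[P]_w (q.*2%:R * (U w ^+ q.*2.-1 * V w) +
                          (U w ^+ 2 + a * V w ^+ 2) ^+ q))).
  apply: Rintegral_ler.
  - exact/has_moments_exp/has_moments_add.
  - apply: has_moments_add.
      by apply/has_moments_scale/has_moments_mul => //; exact: has_moments_exp.
    apply/has_moments_exp/has_moments_add; first exact: has_moments_exp.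
    exact/has_moments_scale/has_moments_exp.
  - by move=> w; exact: even_power_centered.
have mU2 : has_moments P (fun w => U w ^+ 2) by exact: has_moments_exp.
have mV2 : has_moments P (fun w => a * V w ^+ 2).
  exact/has_moments_scale/has_moments_exp.
have mUV : has_moments P (fun w => U w ^+ q.*2.-1 * V w).
  by apply: has_moments_mul => //; exact: has_moments_exp.
rewrite RintegralDm; last 2 first.
- exact: has_moments_scale.
- exact/has_moments_exp/has_moments_add.
rewrite RintegralZm// (@orthogonal_sum k'); last 3 first.
- by move=> J; rewrite -AE1 => /andP[].
- apply: measurable_funX; apply: insensitive_sum => J; rewrite -AE0 => /andP[_ kJ].
  exact: g_insensitive.
- exact: has_moments_exp.
rewrite mulr0 add0r mulrDl -mulrA.
apply: Rintegral_minkowski => //.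
- by move=> w; exact: sqr_ge0.
- by move=> w; rewrite mulr_ge0// sqr_ge0.
- exact: mulr_ge0.
- by rewrite !mulr_ge0.
- by under eq_Rintegral do rewrite -expr_dbl; exact/IH/ltnW.
- under eq_Rintegral do rewrite exprMn -expr_dbl.
  rewrite RintegralZm; last exact: has_moments_exp.
  by rewrite (exprMn q a) ler_wpM2l ?exprn_ge0//; exact/IH/ltnW.
Qed.

Lemma even_moment_sum (q j : nat) (G : R) :
  (0 < q)%N -> 0 <= G ->
  (forall J : {set 'I_N}, #|J| = j -> \int[P]_w (g J w ^+ q.*2) <= G ^+ q) ->
  \int[P]_w ((\sum_(J : {set 'I_N} | #|J| == j) g J w) ^+ q.*2) <=
  ('C(N, j)%:R * (24 * q%:R) ^+ j * G) ^+ q.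
Proof.
move=> q0 G0 gG.
have := @even_moment_sum_agree q G (fun J : {set 'I_N} => #|J| == j) q0 G0.
move=> /(_ _ N finset.set0 (leqnn N)); rewrite -/below => H.
have agT J : agree_from N finset.set0 J.
  by apply/forallP => i; rewrite leqNgt ltn_ord.
have E (S : nmodType) (f : {set 'I_N} -> S) :
    \sum_(J : {set 'I_N} | (#|J| == j) && agree_from N finset.set0 J) f J =
    \sum_(J : {set 'I_N} | #|J| == j) f J.
  by apply: eq_bigl => J; rewrite agT andbT.
have {H} := H (fun J FJ => gG J (eqP FJ)).
under eq_Rintegral do rewrite E.
rewrite E (_ : \sum_(J : {set 'I_N} | _) _ = 'C(N, j)%:R * (24 * q%:R) ^+ j)//.
rewrite (eq_bigr (fun=> (24 * q%:R) ^+ j)) => [|J /eqP <-].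
  rewrite sumr_const -[LHS]mulr_natl -[in 'C(_, _)](card_ord N) -card_draws.
  by congr (_%:R * _); apply: eq_card => J; rewrite inE.
rewrite (_ : J :&: below N = J)//.
by apply/setP => i; rewrite !inE ltn_ord andbT.
Qed.

Section maximal_inequality.
Variables (F : pred {set 'I_N}) (q : nat) (lam : R).
Hypotheses (q0 : (0 < q)%N) (lam0 : 0 < lam).

Let V (n : nat) (w : T) := \sum_(J | F J && (J \subset below n)) g J w.

(* The running indicator of [|V m| > lam for some m <= n]. *)
Fixpoint crossed (n : nat) (w : T) : bool :=
  (lam < `|V n w|) || (if n is m.+1 then crossed m w else false).

Let V_moments n : has_moments P (V n).
Proof. exact: has_moments_sum. Qed.

Let V_insensitive n (k : 'I_N) : (n <= k)%N -> insensitive k (V n).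
Proof.
move=> nk; apply: insensitive_sum => J /andP[_ Jn]; apply: g_insensitive.
by apply/negP => /(fintype.subsetP Jn); rewrite inE ltnNge nk.
Qed.

Lemma crossed_measurable n : measurable_fun setT (crossed n).
Proof.
elim: n => [|n IH] /=; apply: measurable_or => //.
- by apply: measurable_fun_ltr => //; apply: measurableT_comp => //; case: (V_moments 0).
- by apply: measurable_fun_ltr => //; apply: measurableT_comp => //; case: (V_moments n.+1).
Qed.

Lemma crossed_insensitive n (k : 'I_N) : (n <= k)%N ->
  insensitive k (fun w => (crossed n w)%:R).
Proof.
move=> nk; suff H : measurable_fun (setT : set (g_sigma_algebraType (C k))) (crossed n).
  exact: measurable_natr_bool.
elim: n nk => [|n IH] nk /=; apply: measurable_or => //.
- apply: measurable_fun_ltr => //; apply: measurableT_comp => //.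
  exact: V_insensitive.
- apply: measurable_fun_ltr => //; apply: measurableT_comp => //.
  exact: V_insensitive.
- by apply: IH; exact: ltnW.
Qed.

Lemma crossed_moments n : has_moments P (fun w => (crossed n w)%:R).
Proof.
apply: (@has_moments_bounded _ _ _ _ _ 1) => [|w].
  exact/measurable_natr_bool/crossed_measurable.
by rewrite ger0_norm//; case: crossed.
Qed.

Lemma doob_weak n : (n <= N)%N ->
  lam ^+ q.*2 * \int[P]_w (crossed n w)%:R <=
  \int[P]_w ((crossed n w)%:R * V n w ^+ q.*2).
Proof.
have key w m : lam < `|V m w| -> lam ^+ q.*2 <= V m w ^+ q.*2.
  move=> lV; rewrite -[leRHS]ger0_norm ?expr_dbl_ge0// normrX.
  by rewrite lerXn2r ?nnegrE// ltW.
have lq : 0 <= lam ^+ q.*2 by exact: expr_dbl_ge0.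
elim: n => [|n IH] nN.
  rewrite -RintegralZm; last exact: crossed_moments.
  apply: Rintegral_ler.
  - exact/has_moments_scale/crossed_moments.
  - by apply: has_moments_mul; [exact: crossed_moments|exact: has_moments_exp].
  - move=> w /=; have := key w 0%N.
    by case: (lam < _) => /= [/(_ isT)|_]; rewrite ?mulr1 ?mul1r ?mulr0 ?mul0r.
pose b m w : R := (crossed m w)%:R.
have mb m : has_moments P (b m) by exact: crossed_moments.
pose D w := \sum_(J | (F J && (J \subset below n.+1)) && ~~ (J \subset below n)) g J w.
have VS w : V n.+1 w = V n w + D w.
  rewrite /V /D (bigID (fun J : {set 'I_N} => J \subset below n)) /=; congr (_ + _).
  apply: eq_bigl => J; rewrite -andbA; congr (_ && _).
  apply: andb_idl => /fintype.subset_trans; apply; apply/fintype.subsetP => i.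
  by rewrite !inE => /ltnW; rewrite ltnS.
have mD : has_moments P D by exact: has_moments_sum.
have mVq m : has_moments P (fun w => V m w ^+ q.*2) by exact: has_moments_exp.
have mbV : has_moments P (fun w => b n w * V n w ^+ q.*2.-1).
  by apply: has_moments_mul => //; exact: has_moments_exp.
have orth : \int[P]_w (b n w * V n w ^+ q.*2.-1 * D w) = 0.
  apply: (@orthogonal_sum (Ordinal nN)) => //.
    move=> J /andP[/andP[_ Jn1]]; apply: contraNT => nJ; apply/fintype.subsetP => i iJ.
    have := fintype.subsetP Jn1 _ iJ; rewrite !inE ltnS leq_eqVlt => /predU1P[ein|//].
    by move: nJ; rewrite (_ : Ordinal nN = i) ?iJ//; exact/val_inj.
  apply: measurable_funM; first exact: crossed_insensitive.
  by apply: measurable_funX; exact: V_insensitive.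
have step w : lam ^+ q.*2 * b n.+1 w + b n w * V n w ^+ q.*2
    + q.*2%:R * (b n w * V n w ^+ q.*2.-1 * D w)
    <= b n.+1 w * V n.+1 w ^+ q.*2 + lam ^+ q.*2 * b n w.
  have tan := even_power_tangent (V n w) (D w) q0; rewrite -VS in tan.
  rewrite /b /=; have := key w n.+1.
  case: (crossed n w); rewrite ?orbT ?orbF /=.
    by move=> _; rewrite !mul1r !mulr1; lra.
  case: (lam < _) => /= [/(_ isT)|_]; rewrite !(mulr1, mul1r, mulr0, mul0r) ?addr0 //.
have mbD := has_moments_mul mbV mD.
have mbVq := has_moments_mul (mb n) (mVq n).
have mbVq1 := has_moments_mul (mb n.+1) (mVq n.+1).
have mlb m := has_moments_scale (lam ^+ q.*2) (mb m).
have mqbD := has_moments_scale q.*2%:R mbD.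
have := Rintegral_ler
  (has_moments_add (has_moments_add (mlb n.+1) mbVq) mqbD)
  (has_moments_add mbVq1 (mlb n)) step.
rewrite (RintegralDm (has_moments_add (mlb n.+1) mbVq) mqbD).
rewrite (RintegralDm (mlb n.+1) mbVq) (RintegralDm mbVq1 (mlb n)).
rewrite !RintegralZm// orth mulr0 addr0 => H.
have {}IH := IH (ltnW nN); rewrite -/(b n) -/(b n.+1) in IH *.
by have := lerD H IH; rewrite -/(b n) -/(b n.+1); lra.
Qed.

Lemma crossedP n w :
  reflect (exists2 m, (m <= n)%N & lam < `|V m w|) (crossed n w).
Proof.
elim: n => [|n IH] /=.
  rewrite orbF; apply: (iffP idP) => [lV|[m]]; first by exists 0%N.
  by rewrite leqn0 => /eqP ->.
apply: (iffP orP) => [[lV|/IH[m mn lV]]|[m]]; [by exists n.+1| |].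
  by exists m => //; exact: leqW.
rewrite leq_eqVlt => /predU1P[->|mn lV]; first by left.
by right; apply/IH; exists m.
Qed.

Lemma exceedance_crossed :
  [set w | exists2 n, (n <= N)%N & lam < `|V n w|] = [set w | crossed N w].
Proof. by apply/seteqP; split => w /= /crossedP. Qed.

Lemma measurable_exceedance :
  measurable [set w | exists2 n, (n <= N)%N & lam < `|V n w|].
Proof.
rewrite exceedance_crossed -[X in measurable X]setTI.
have H := crossed_measurable N measurableT.
by apply: (H [set true]%classic).
Qed.

Lemma exceedance_le :
  (P [set w | exists2 n, (n <= N)%N & (lam < `|V n w|)%R] <=
   ((\int[P]_w ((\sum_(J | F J) g J w) ^+ q.*2)) / lam ^+ q.*2)%:E)%E.
Proof.
have := measurable_exceedance; rewrite exceedance_crossed => mcr.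
have EP : \int[P]_w (crossed N w)%:R = fine (P [set w | crossed N w]).
  rewrite -[X in P X]setIT -integral_indic//; congr fine.
  apply: eq_integral => w _; rewrite indicE; congr (_%:R%:E).
  case: (boolP (crossed N w)) => cw; first by rewrite mem_set.
  by rewrite memNset//=; exact/negP.
rewrite -[leLHS]fineK; last exact: fin_num_measure.
rewrite lee_fin ler_pdivlMr ?exprn_gt0// mulrC -EP.
apply: le_trans (doob_weak (leqnn N)) _.
apply: Rintegral_ler.
- by apply: has_moments_mul; [exact: crossed_moments|exact: has_moments_exp].
- by apply/has_moments_exp/has_moments_sum.
move=> w; rewrite (_ : V N w = \sum_(J | F J) g J w); last first.
  apply: eq_bigl => J; rewrite (_ : J \subset _) ?andbT//.
  by apply/fintype.subsetP => i _; rewrite inE ltn_ord.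
by case: crossed; rewrite ?mul1r// mul0r expr_dbl_ge0.
Qed.

End maximal_inequality.

End orthogonal_families.

(** * Independence and Fubini *)

Section independence_fubini.
Context d d1 d2 (T : measurableType d) (T1 : measurableType d1)
  (T2 : measurableType d2) (R : realType) (P : probability T R).
Variables (U : {mfun T >-> T1}) (V : {mfun T >-> T2}).
Hypothesis UV_indep : forall A B, measurable A -> measurable B ->
  P (U @^-1` A `&` V @^-1` B) = (P (U @^-1` A) * P (V @^-1` B))%E.

Let UV w := (U w, V w).

Let mUV : measurable_fun setT UV.
Proof. exact: measurable_fun_pair. Qed.

Let UV_mfun : {mfun T >-> (T1 * T2)%type} :=
  HB.pack UV (isMeasurableFun.Build _ _ _ _ _ mUV).

Lemma independent_joint_law A : measurable A ->
  (distribution P U \x distribution P V)%E A = pushforward P UV A.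
Proof.
move=> mA; by rewrite (@product_measure_unique _ _ _ _ _ _ _ (distribution P UV_mfun)).
Qed.

Lemma ge0_independent_fubini (F : T1 * T2 -> \bar R) :
  measurable_fun setT F -> (forall z, 0 <= F z)%E ->
  (\int[P]_w F (U w, V w) =
   \int[P]_w \int[pushforward P V]_y F (U w, y))%E.
Proof.
move=> mF F0.
transitivity (\int[pushforward P UV]_z F z)%E.
  by rewrite ge0_integral_pushforward.
transitivity (\int[(distribution P U \x distribution P V)%E]_z F z)%E.
  by apply: eq_measure_integral => A mA _; exact/esym/independent_joint_law.
rewrite fubini_tonelli1// ge0_integral_pushforward//.
  exact: measurable_fun_fubini_tonelli_F.
by move=> y _; exact: integral_ge0.
Qed.

Lemma independent_fubini (F : T1 * T2 -> \bar R) :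
  measurable_fun setT F -> P.-integrable setT (fun w => F (U w, V w)) ->
  (\int[P]_w F (U w, V w) =
   \int[P]_w \int[pushforward P V]_y F (U w, y))%E /\
  {ae P, forall w, (pushforward P V).-integrable setT (fun y => F (U w, y))}.
Proof.
move=> mF iF.
have iF1 : (pushforward P UV).-integrable setT F by exact: integrable_pushforward.
have iF2 : (distribution P U \x distribution P V)%E.-integrable setT F.
  apply/integrableP; split => //; move/integrableP : iF1 => [_].
  congr (_ < _)%E; apply: eq_measure_integral => A mA _.
  exact/esym/independent_joint_law.
split.
  transitivity (\int[pushforward P UV]_z F z)%E.
    by rewrite integral_pushforward.
  transitivity (\int[(distribution P U \x distribution P V)%E]_z F z)%E.
    by apply: eq_measure_integral => A mA _; exact/esym/independent_joint_law.
  rewrite -integral12_prod_meas1// integral_pushforward//.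
    exact: (measurable_fubini_F iF2).
  have mFF := measurable_fubini_F iF2.
  have iFF := integrable_fubini_F iF2.
  rewrite preimage_setT; apply/integrableP; split.
    exact: (measurableT_comp mFF).
  move/integrableP : iFF => [_]; rewrite ge0_integral_pushforward//.
  exact: (measurableT_comp _ mFF).
have := ae_integrable1 iF2; case=> N [mN N0 sN].
exists (U @^-1` N); split => //.
  by rewrite -[X in measurable X]setTI; exact: measurable_funPT.
by move=> w /= nw; apply: sN.
Qed.

End independence_fubini.

Section seq_kernels.
Context d (S : measurableType d) (R : realType) (mu : set S -> \bar R).

(* A kernel on [S^a] is encoded as a function on sequences, of which only the
   values on sequences of size [a] matter. *)
Definition seq_measurable (a : nat) (F : seq S -> \bar R) :=
  forall d0 (T0 : measurableType d0) (f : nat -> T0 -> S),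
    (forall i, measurable_fun setT (f i)) ->
    measurable_fun setT (fun w => F (mkseq (f^~ w) a)).

Lemma seq_measurable_map (l : seq nat) F d0 (T0 : measurableType d0)
    (Z : nat -> T0 -> S) :
  seq_measurable (size l) F -> (forall k, k \in l -> measurable_fun setT (Z k)) ->
  measurable_fun setT (fun w => F (map (Z^~ w) l)).
Proof.
move=> mF mZ.
pose f i := if (i < size l)%N then Z (nth 0%N l i) else cst point.
have mf i : measurable_fun setT (f i).
  by rewrite /f; case: ltnP => // il; exact/mZ/mem_nth.
have := mF _ _ f mf; congr measurable_fun; apply/funext => w; congr F.
rewrite -[in RHS](mkseq_nth 0%N l) /mkseq -map_comp.
apply/eq_in_map => i; rewrite mem_iota add0n => /= il.
by rewrite /f il.
Qed.

Lemma mkseq_cons (U : Type) (f : nat -> U) n :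
  mkseq f n.+1 = f 0%N :: mkseq (f \o succn) n.
Proof. by rewrite /mkseq /= -[1%N]addn0 iotaDl -map_comp. Qed.

End seq_kernels.

Section iid_sequence.
Context d d' (T : measurableType d) (S : measurableType d') (R : realType)
  (P : probability T R) (X : nat -> T -> S).
Hypothesis mX : forall k, measurable_fun setT (X k).
Hypothesis X_iid : iid P X.

(* A pi-system generating the sigma-algebra of all variables but [X k]. *)
Definition others (k : nat) : set (set T) :=
  [set A | exists (J : {fset nat}) (B : nat -> set S),
    [/\ forall l, measurable (B l), k \notin J &
        A = \bigcap_(l in [set` J]) X l @^-1` B l]].

Lemma others_measurable k : others k `<=` measurable.
Proof.
move=> _ [J [B [mB _ ->]]]; apply: fin_bigcap_measurable => //.
by move=> l _; rewrite -[X in measurable X]setTI; exact: mX.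
Qed.

Lemma others_setI k : setI_closed (others k).
Proof.
move=> _ _ [J1 [B1 [mB1 kJ1 ->]]] [J2 [B2 [mB2 kJ2 ->]]].
pose B l := (if l \in J1 then B1 l else setT) `&` (if l \in J2 then B2 l else setT).
exists (J1 `|` J2)%fset, B; split.
- by move=> l; apply: measurableI; case: ifP.
- by rewrite in_fsetU negb_or kJ1.
apply/seteqP; split => w /=.
  move=> [w1 w2] l /= _; rewrite /B; split.
    by case: ifPn => // lJ; apply: w1.
  by case: ifPn => // lJ; apply: w2.
move=> H; split => l /= lJ.
  have [|+ _] := H l; first by rewrite /= in_fsetU lJ.
  by rewrite lJ.
have [|_] := H l; first by rewrite /= in_fsetU lJ orbT.
by rewrite lJ.
Qed.

Lemma others_setT k : others k setT.
Proof.
exists fset0, (fun=> setT); split => //.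
by apply/seteqP; split.
Qed.

Lemma others_indep k A D : <<s others k >> A -> measurable D ->
  P (A `&` X k @^-1` D) = (P A * P (X k @^-1` D))%E.
Proof.
move=> sA mD; have [ind _] := X_iid.
have mXD : measurable (X k @^-1` D).
  by rewrite -[X in measurable X]setTI; exact: mX.
have [c cE] : exists c : {nonneg R}, P (X k @^-1` D) = c%:num%:E.
  have c0 : 0 <= fine (P (X k @^-1` D)) by apply: fine_ge0; exact: measure_ge0.
  by exists (NngNum c0); rewrite /= fineK// fin_num_measure.
have := @g_sigma_algebra_measure_unique _ R T (others k) (others_measurable (k := k))
  (fun=> setT) (fun=> others_setT k) _ (mrestr P mXD) (mscale c P) (others_setI (k := k)).
rewrite /= /mrestr /mscale => /(_ _ _ _ A sA) ->.
- by rewrite cE muleC.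
- by rewrite bigcup_const.
- move=> _ [J [B [mB kJ ->]]].
  pose B' l := if l == k then D else B l.
  have mB' l : measurable (B' l) by rewrite /B'; case: ifP.
  have bigE : \bigcap_(l in [set` (k |` J)%fset]) X l @^-1` B' l =
      \bigcap_(l in [set` J]) X l @^-1` B l `&` X k @^-1` D.
    apply/seteqP; split => w /=.
      move=> H; split.
        move=> l /= lJ; have := H l; rewrite /= /B' in_fset1U lJ orbT => /(_ isT).
        by case: eqP => // lk; rewrite lk (negbTE kJ) in lJ.
      by have := H k; rewrite /= /B' eqxx in_fset1U eqxx => /(_ isT).
    move=> [H1 H2] l /=; rewrite in_fset1U /B'.
    by case: eqP => [->//|_] /= lJ; exact: H1.
  transitivity (c%:num%:E * \prod_(l <- J) P (X l @^-1` B l))%E; last first.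
    by congr (_ * _)%E; exact/esym/ind.
  rewrite -bigE (ind (k |` J)%fset B' mB') big_fsetU1//= {1}/B' eqxx cE.
  congr (_ * _)%E; rewrite !big_seq; apply: eq_bigr => l lJ.
  by rewrite /B'; case: eqP => // lk; rewrite lk (negbTE kJ) in lJ.
- move=> _; apply: le_lt_trans (probability_le1 P _) _; last by rewrite ltry.
  by rewrite setTI.
Qed.

Local Notation Tk k := (g_sigma_algebraType (others k)).

Lemma others_sub k : <<s others k >> `<=` measurable.
Proof.
by apply: smallest_sub; [exact: sigma_algebra_measurable|exact: others_measurable].
Qed.

Lemma others_id k : measurable_fun setT (idfun : T -> Tk k).
Proof. by move=> _ A; rewrite setTI => sA; exact: (@others_sub k). Qed.

Lemma others_X k l : l != k -> measurable_fun (setT : set (Tk k)) (X l).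
Proof.
move=> lk _ A mA; rewrite setTI; apply: sub_sigma_algebra.
exists [fset l]%fset, (fun=> A); split => //.
  by rewrite in_fset1 eq_sym.
apply/seteqP; split => w /=.
  by move=> Aw m /=; rewrite in_fset1 => /eqP ->.
by move=> /(_ l) /=; rewrite in_fset1 eqxx => /(_ isT).
Qed.

Let mu := pushforward P (X 0).

Lemma integral_law k (f : S -> \bar R) :
  (\int[pushforward P (X k)]_y f y = \int[mu]_y f y)%E.
Proof.
apply: eq_measure_integral => A mA _; have [_ id] := X_iid.
exact: id.
Qed.

Section one_variable.
Variable k : nat.

Let midk : measurable_fun setT (idfun : T -> Tk k). Proof. exact: others_id. Qed.
Let mXk : measurable_fun setT (X k). Proof. exact: mX. Qed.

Let Uk : {mfun T >-> Tk k} :=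
  HB.pack (idfun : T -> Tk k) (isMeasurableFun.Build _ _ _ _ _ midk).
Let Vk : {mfun T >-> S} := HB.pack (X k) (isMeasurableFun.Build _ _ _ _ _ mXk).

Let UV_indep A B : measurable A -> measurable B ->
  P (Uk @^-1` A `&` Vk @^-1` B) = (P (Uk @^-1` A) * P (Vk @^-1` B))%E.
Proof. by move=> mA mB; exact: others_indep. Qed.

Lemma ge0_integrate_out (F : Tk k * S -> \bar R) :
  measurable_fun setT F -> (forall z, 0 <= F z)%E ->
  (\int[P]_w F (w, X k w) = \int[P]_w \int[mu]_y F (w, y))%E.
Proof.
move=> mF F0; rewrite (ge0_independent_fubini UV_indep mF F0).
by apply: eq_integral => w _; exact: integral_law.
Qed.

Lemma integrate_out (F : Tk k * S -> \bar R) :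
  measurable_fun setT F -> P.-integrable setT (fun w => F (w, X k w)) ->
  (\int[P]_w F (w, X k w) = \int[P]_w \int[mu]_y F (w, y))%E /\
  {ae P, forall w, mu.-integrable setT (fun y => F (w, y))}.
Proof.
move=> mF iF; have [-> ae] := independent_fubini UV_indep mF iF.
split; first by apply: eq_integral => w _; exact: integral_law.
apply: filterS ae => w /integrableP[mFw Fw]; apply/integrableP; split => //.
by rewrite -(integral_law k).
Qed.

End one_variable.

End iid_sequence.

(** * Conditional expectations of the kernel *)

Lemma exists_notin (l : seq nat) : exists k, k \notin l.
Proof.
exists (\max_(i <- l) i).+1; apply/negP => kl.
by have := @leq_bigmax_seq _ l xpredT id _ kl isT; rewrite ltnn.
Qed.

Section seq_measurable_integral.
Context d (S : measurableType d) (R : realType)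
  (mu : {sigma_finite_measure set S -> \bar R}).

Lemma seq_measurable_cons a (F : seq S -> \bar R) d0 (T0 : measurableType d0)
    (f : nat -> T0 -> S) :
  seq_measurable a.+1 F -> (forall i, measurable_fun setT (f i)) ->
  measurable_fun setT (fun z : T0 * S => F (z.2 :: mkseq (f^~ z.1) a)).
Proof.
move=> mF mf; pose f' i (z : T0 * S) := if i is j.+1 then f j z.1 else z.2.
have mf' i : measurable_fun setT (f' i).
  by case: i => [|i] /=; [exact: measurable_snd|exact: measurableT_comp].
have := mF _ _ f' mf'; congr measurable_fun; apply/funext => z.
by rewrite mkseq_cons.
Qed.

Lemma measurable_partial_integral d0 (T0 : measurableType d0)
    (G : T0 * S -> \bar R) :
  measurable_fun setT G -> measurable_fun setT (fun w => \int[mu]_y G (w, y))%E.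
Proof.
move=> mG; rewrite [X in measurable_fun _ X](_ : _ = (fun w =>
  \int[mu]_y (G^\+ (w, y)) - \int[mu]_y (G^\- (w, y)))%E).
  apply: emeasurable_funB.
    have := @measurable_fun_fubini_tonelli_F _ _ T0 S R mu G^\+%E.
    by apply => //; exact: measurable_funepos.
  have := @measurable_fun_fubini_tonelli_F _ _ T0 S R mu G^\-%E.
  by apply => //; exact: measurable_funeneg.
apply/funext => w; rewrite integralE; congr (_ - _)%E; apply: eq_integral => y _.
  by rewrite unlock.
by rewrite unlock.
Qed.

Lemma seq_measurable_integral a (F : seq S -> \bar R) :
  seq_measurable a.+1 F -> seq_measurable a (fun l => \int[mu]_y F (y :: l))%E.
Proof.
move=> mF d0 T0 f mf.
exact: measurable_partial_integral (seq_measurable_cons mF mf).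
Qed.

End seq_measurable_integral.

Section jensen.
Context d (S : measurableType d) (R : realType) (mu : probability S R).

Lemma jensen_even (f : S -> R) (q : nat) : (0 < q)%N -> measurable_fun setT f ->
  ((fine (\int[mu]_y (f y)%:E) ^+ q.*2)%:E <= \int[mu]_y (f y ^+ q.*2)%:E)%E.
Proof.
move=> q0 mf; have mfq : measurable_fun setT (fun y => f y ^+ q.*2).
  exact: measurable_funX.
have [ifq|nfq] := pselect (mu.-integrable setT (fun y => (f y ^+ q.*2)%:E)); last first.
  suff -> : (\int[mu]_y (f y ^+ q.*2)%:E = +oo)%E by rewrite leey.
  apply/eqP; rewrite eq_le leey /= leNgt; apply/negP => lty; apply: nfq.
  apply/integrableP; split; first exact/measurable_EFinP.
  by under eq_integral do rewrite /= ger0_norm ?expr_dbl_ge0//.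
have f_int : mu.-integrable setT (EFin \o f).
  apply: (@integrable_dominated _ _ _ _ _ (fun y => 1 + f y ^+ q.*2)) => //.
    move=> y; have [y1|/ltW y1] := leP `|f y| 1.
      by rewrite (le_trans y1)// lerDl expr_dbl_ge0.
    rewrite (@le_trans _ _ (`|f y| ^+ q.*2)) ?ler_eXnr ?double_gt0//.
    by rewrite -normrX ger0_norm ?expr_dbl_ge0// lerDr.
  rewrite (_ : EFin \o _ = (EFin \o cst 1%R) \+ (fun y => (f y ^+ q.*2)%:E))//.
  by apply: integrableD => //; exact: finite_measure_integrable_cst.
pose c := fine (\int[mu]_y (f y)%:E).
have cE : c = \int[mu]_y f y by [].
have : \int[mu]_y (c ^+ q.*2 + q.*2%:R * c ^+ q.*2.-1 * (f y - c)) <=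
       \int[mu]_y (f y ^+ q.*2).
  apply: le_Rintegral => //.
    rewrite (_ : EFin \o _ = (EFin \o cst (c ^+ q.*2)%R) \+ (fun y =>
      (q.*2%:R * c ^+ q.*2.-1)%:E * ((EFin \o f) y - (EFin \o cst c) y))%E)//.
    apply: integrableD => //; first exact: finite_measure_integrable_cst.
    apply: integrableZl => //; apply: integrableB => //.
    exact: finite_measure_integrable_cst.
  move=> y _; have := even_power_tangent c (f y - c) q0.
  by rewrite mulrA (_ : c + (f y - c) = f y)// addrC subrK.
have icst (e : R) : mu.-integrable setT (EFin \o cst e) by exact: finite_measure_integrable_cst.
have iB : mu.-integrable setT (EFin \o (fun y => f y - c)).
  exact: (integrableB measurableT f_int (icst c)).
have iZ := integrableZl measurableT (q.*2%:R * c ^+ q.*2.-1) iB.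
rewrite (RintegralD measurableT (icst _) iZ) (RintegralZl _ measurableT iB).
rewrite (RintegralB measurableT f_int (icst c)) -cE !Rintegral_cst1 subrr mulr0 addr0.
rewrite -lee_fin => /le_trans; apply.
by rewrite /Rintegral fineK//; exact: (integrable_fin_num measurableT ifq).
Qed.

End jensen.

Section projections.
Context d d' (T : measurableType d) (S : measurableType d') (R : realType)
  (P : probability T R) (X : nat -> T -> S) (r : nat) (h : r.-tuple S -> R).
Hypothesis mX : forall k, measurable_fun setT (X k).
Hypothesis X_iid : iid P X.
Hypothesis mh : measurable_fun setT h.
Hypothesis h_sym : symmetric_kernel h.

Let mX0 : measurable_fun setT (X 0%N). Proof. exact: mX. Qed.
Let X0 : {mfun T >-> S} := HB.pack (X 0%N) (isMeasurableFun.Build _ _ _ _ _ mX0).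
Let mu : probability S R := distribution P X0.

Definition seq_kernel (l : seq S) : R := oapp h 0 (insub l : option (r.-tuple S)).

(* [marginal m l] integrates [m] arguments of [h] against the law of [X 0];
   the remaining ones are the entries of [l]. *)
Fixpoint marginal (m : nat) (l : seq S) : R :=
  if m is m'.+1 then
    fine (\int[pushforward P (X 0%N)]_y (marginal m' (y :: l))%:E)
  else seq_kernel l.

(* E[h(X_l, ...) | X_l] *)
Definition kproj (l : seq nat) (w : T) : R :=
  marginal (r - size l) (map (X^~ w) l).

Lemma seq_kernel_tuple (t : r.-tuple S) : seq_kernel t = h t.
Proof. by rewrite /seq_kernel valK. Qed.

Lemma marginal_perm m (l l' : seq S) : perm_eq l l' -> marginal m l = marginal m l'.
Proof.
elim: m l l' => [|m IH] l l' ll' /=; last first.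
  by congr fine; apply: (@eq_integral _ _ _ mu) => y _; rewrite (IH (y :: l) (y :: l')) ?perm_cons.
have [sl|sl] := eqVneq (size l) r; last first.
  by rewrite /seq_kernel !insubN -?(perm_size ll').
have sl' : size l' = r by rewrite -(perm_size ll').
pose t := Tuple (introT eqP sl); pose t' := Tuple (introT eqP sl').
rewrite -[l]/(tval t) -[l']/(tval t') !seq_kernel_tuple.
have /tuple_permP[s E] : perm_eq t t' by [].
rewrite -[RHS](h_sym s); congr h; apply: val_inj; exact: E.
Qed.

Lemma marginal_measurable m : (m <= r)%N ->
  seq_measurable (r - m) (EFin \o marginal m).
Proof.
elim: m => [|m IH] mr.
  rewrite subn0 => d0 T0 f mf /=; apply/measurable_EFinP.
  rewrite (_ : (fun w => _) = (fun w => h [tuple f i w | i < r])).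
    apply: measurableT_comp => //; apply/measurable_fun_tnthP => i.
    rewrite (_ : _ \o _ = f i)//; apply/funext => w /=.
    by rewrite tnth_mktuple.
  apply/funext => w; rewrite -seq_kernel_tuple; congr seq_kernel.
  by rewrite /= /mkseq -val_enum_ord -map_comp.
have := IH (ltnW mr); rewrite -(subnSK mr) => /(seq_measurable_integral mu).
move=> H d0 T0 f mf; have {}H := H _ _ f mf.
by apply: measurableT_comp => //; exact: measurableT_comp.
Qed.

Lemma marginal_measurable_fst (l : seq nat) k : (size l < r)%N -> k \notin l ->
  measurable_fun setT (fun z : g_sigma_algebraType (others X k) * S =>
    marginal (r - (size l).+1) (z.2 :: map (X^~ z.1) l)).
Proof.
move=> lr kl; set m := (r - _)%N.
pose Z i (z : g_sigma_algebraType (others X k) * S) :=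
  if i is j.+1 then X j z.1 else z.2.
have := @seq_measurable_map _ S R (0%N :: map succn l) (EFin \o marginal m) _ _ Z.
rewrite /= size_map => H; apply/measurable_EFinP.
have -> : EFin \o (fun z : g_sigma_algebraType (others X k) * S =>
    marginal m (z.2 :: map (X^~ z.1) l)) =
  (fun z => (marginal m (z.2 :: map (Z^~ z) (map succn l)))%:E).
  by apply/funext => z /=; rewrite -map_comp.
apply: H.
  have := @marginal_measurable m; rewrite /m subKn//; apply.
  by rewrite leq_subr.
move=> i; rewrite inE => /predU1P[->|/mapP[j jl ->]] /=; first exact: measurable_snd.
apply: (measurableT_comp (f := X j : g_sigma_algebraType (others X k) -> S)) => //.
by apply: others_X; apply: contraNneq kl => <-.
Qed.

Lemma projE l w : (size l < r)%N ->
  kproj l w = fine (\int[mu]_y (marginal (r - (size l).+1) (y :: map (X^~ w) l))%:E).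
Proof. by move=> lr; rewrite /kproj -(subnSK lr). Qed.

Lemma proj_insensitive k l : (size l <= r)%N -> k \notin l ->
  insensitive (others X) k (kproj l).
Proof.
move=> lr kl; apply/measurable_EFinP.
apply: (@seq_measurable_map _ S R l (EFin \o marginal (r - size l)) _
  (g_sigma_algebraType (others X k)) X).
  have := @marginal_measurable (r - size l); rewrite subKn//; apply.
  by rewrite leq_subr.
by move=> j jl; apply: others_X; apply: contraNneq kl => <-.
Qed.

Lemma proj_measurable l : (size l <= r)%N -> measurable_fun setT (kproj l).
Proof.
move=> lr; apply/measurable_EFinP.
apply: (@seq_measurable_map _ S R l (EFin \o marginal (r - size l)) _ T X).
  have := @marginal_measurable (r - size l); rewrite subKn//; apply.
  by rewrite leq_subr.
by move=> j jl; exact: mX.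
Qed.

Lemma proj_perm l l' w : perm_eq l l' -> kproj l w = kproj l' w.
Proof.
by move=> ll'; rewrite /kproj (perm_size ll'); apply/marginal_perm/perm_map.
Qed.

Lemma proj_contraction q k l : (0 < q)%N -> (size l < r)%N -> k \notin l ->
  (\int[P]_w (kproj l w ^+ q.*2)%:E <= \int[P]_w (kproj (k :: l) w ^+ q.*2)%:E)%E.
Proof.
move=> q0 lr kl; have mk := marginal_measurable_fst lr kl.
pose F (z : g_sigma_algebraType (others X k) * S) :=
  ((marginal (r - (size l).+1) (z.2 :: map (X^~ z.1) l)) ^+ q.*2)%:E.
have mF : measurable_fun setT F by apply/measurable_EFinP; exact: measurable_funX.
have F0 z : (0 <= F z)%E by rewrite lee_fin expr_dbl_ge0.
rewrite (ge0_integrate_out mX X_iid mF F0).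
apply: ge0_le_integral => //.
- by move=> w _; rewrite lee_fin expr_dbl_ge0.
- by apply/measurable_EFinP; apply: measurable_funX; exact/proj_measurable/ltnW.
- exact: (measurableT_comp (measurable_partial_integral mu mF) (others_id mX (k := k))).
- move=> w _; rewrite projE//; apply: jensen_even => //.
  exact: (measurableT_comp mk (pair1_measurable (w : g_sigma_algebraType (others X k)))).
Qed.

Lemma proj_orthogonal k l phi : (size l < r)%N -> k \notin l ->
  has_moments P (kproj (k :: l)) -> has_moments P (kproj l) ->
  insensitive (others X) k phi -> has_moments P phi ->
  \int[P]_w (phi w * kproj (k :: l) w) = \int[P]_w (phi w * kproj l w).
Proof.
move=> lr kl mkl ml iphi mphi; have mk := marginal_measurable_fst lr kl.
pose G (z : g_sigma_algebraType (others X k) * S) :=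
  marginal (r - (size l).+1) (z.2 :: map (X^~ z.1) l).
pose F (z : g_sigma_algebraType (others X k) * S) := (phi z.1 * G z)%:E.
have mF : measurable_fun setT F.
  apply/measurable_EFinP; apply: measurable_funM => //.
  exact: (measurableT_comp iphi measurable_fst).
have [EF _] := integrate_out mX X_iid mF (has_moments_int (has_moments_mul mphi mkl)).
have mG : measurable_fun setT (EFin \o G) by exact/measurable_EFinP.
have [_ aeG] := integrate_out mX X_iid mG (has_moments_int mkl).
congr fine; rewrite [LHS]EF.
apply: ae_eq_integral => //.
- exact: (measurableT_comp (measurable_partial_integral mu mF) (others_id mX (k := k))).
- by apply/measurable_EFinP; apply: measurable_funM; [case: mphi|case: ml].
- case: aeG => N [mN N0 sN]; exists N; split => // w; apply: contra_notP => nNw.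
  have iG : (pushforward P (X 0%N)).-integrable setT (fun y => (EFin \o G) (w, y)).
    by apply: contra_notP nNw; exact: sN.
  move=> _; rewrite /F /= projE//.
  under eq_integral do rewrite EFinM.
  rewrite integralZl// -[X in (_ * X)%E]fineK//.
  exact: (integrable_fin_num measurableT iG).
Qed.

Fixpoint iterated_integral (a : nat) (F : seq S -> \bar R) : \bar R :=
  if a is b.+1 then
    iterated_integral b (fun l => \int[pushforward P (X 0%N)]_y F (y :: l))%E
  else F [::].

Lemma integral_iterated (l : seq nat) (F : seq S -> \bar R) :
  seq_measurable (size l) F -> (forall s, 0 <= F s)%E -> uniq l ->
  (\int[P]_w F (map (X^~ w) l) = iterated_integral (size l) F)%E.
Proof.
elim: l F => [|k l IH] F mF F0 /=.
  move=> _; rewrite integral_cst// [X in (_ * X)%E](_ : _ = 1%E) ?mule1//.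
  exact: probability_setT.
move=> /andP[kl ul]; rewrite -IH//; last 2 first.
- exact: (seq_measurable_integral mu).
- by move=> s; exact: integral_ge0.
pose G (z : g_sigma_algebraType (others X k) * S) := F (z.2 :: map (X^~ z.1) l).
apply: (ge0_integrate_out mX X_iid (F := G)); last by move=> z; exact: F0.
pose Z i (z : g_sigma_algebraType (others X k) * S) :=
  if i is j.+1 then X j z.1 else z.2.
have := @seq_measurable_map _ S R (0%N :: map succn l) F _ _ Z.
have -> : G = (fun z => F (map (Z^~ z) (0%N :: map succn l))).
  by apply/funext => z /=; rewrite -map_comp.
rewrite /= size_map; apply => // i.
rewrite inE => /predU1P[->|/mapP[j jl ->]] /=; first exact: measurable_snd.
apply: (measurableT_comp (f := X j : g_sigma_algebraType (others X k) -> S)) => //.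
by apply: others_X; apply: contraNneq kl => <-.
Qed.

Lemma proj_law q (l l' : seq nat) : (size l <= r)%N -> size l' = size l ->
  uniq l -> uniq l' ->
  (\int[P]_w (kproj l w ^+ q.*2)%:E = \int[P]_w (kproj l' w ^+ q.*2)%:E)%E.
Proof.
move=> lr ll' ul ul'; rewrite /kproj ll'.
pose F s := (marginal (r - size l) s ^+ q.*2)%:E.
have mF : seq_measurable (size l) F.
  move=> d0 T0 f mf; apply/measurable_EFinP/measurable_funX/measurable_EFinP.
  have := @marginal_measurable (r - size l); rewrite subKn// leq_subr => /(_ isT).
  by move/(_ _ _ f mf).
have F0 s : (0 <= F s)%E by rewrite lee_fin expr_dbl_ge0.
by rewrite [LHS](integral_iterated mF)// [RHS](@integral_iterated l' F)// ll'.
Qed.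

Lemma proj_first w : kproj (iota 0 r) w = first_value h X w.
Proof.
rewrite /kproj size_iota subnn /= /first_value -seq_kernel_tuple; congr seq_kernel.
by rewrite /= -val_enum_ord -map_comp.
Qed.

Hypothesis Y_moments : has_moments P (first_value h X).

Lemma proj_bounded q l : (0 < q)%N -> (size l <= r)%N -> uniq l ->
  (\int[P]_w (kproj l w ^+ q.*2)%:E <= \int[P]_w (first_value h X w ^+ q.*2)%:E)%E.
Proof.
move=> q0; have [n] := ubnP (r - size l); elim: n l => // n IH l ln lr ul.
have [lr'|] := ltnP (size l) r; last first.
  move=> rl; rewrite (@proj_law q l (iota 0 r))//; last 2 first.
  - by rewrite size_iota; apply/eqP; rewrite eqn_leq rl lr.
  - exact: iota_uniq.
  by under eq_integral do rewrite proj_first.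
have [k kl] := exists_notin l.
apply: le_trans (proj_contraction q0 lr' kl) _; apply: IH => //=; last by rewrite kl.
by rewrite -(subnSK lr') in ln.
Qed.

Lemma proj_moments l : (size l <= r)%N -> uniq l -> has_moments P (kproj l).
Proof.
move=> lr ul; apply: has_moments_dominated; first exact: proj_measurable.
case=> [|m].
  exists (fun=> 1); first exact: finite_measure_integrable_cst.
  by move=> w; rewrite expr0.
exists (fun w => kproj l w ^+ m.+1.*2) => //; apply/integrableP; split.
  exact/measurable_EFinP/measurable_funX/proj_measurable.
under eq_integral do rewrite /= ger0_norm ?expr_dbl_ge0//.
apply: le_lt_trans (proj_bounded _ lr ul) _ => //.
have [_ /(_ m.+1.*2)/integrableP[_]] := Y_moments.
by under eq_integral do rewrite /= ger0_norm ?expr_dbl_ge0//.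
Qed.

Lemma proj_moment_le q l : (0 < q)%N -> (size l <= r)%N -> uniq l ->
  \int[P]_w (kproj l w ^+ q.*2) <= \int[P]_w (first_value h X w ^+ q.*2).
Proof.
move=> q0 lr ul; apply: fine_le; last exact: proj_bounded.
  have [_ /(_ q.*2)] := proj_moments lr ul.
  exact: integrable_fin_num.
have [_ /(_ q.*2)] := Y_moments.
exact: integrable_fin_num.
Qed.

End projections.

Section degeneracy.
Context d d' (T : measurableType d) (S : measurableType d') (R : realType)
  (P : probability T R) (X : nat -> T -> S) (r : nat) (h : r.-tuple S -> R).
Hypothesis mX : forall k, measurable_fun setT (X k).
Hypothesis X_iid : iid P X.
Hypothesis mh : measurable_fun setT h.
Hypothesis h_sym : symmetric_kernel h.
Hypothesis Y_moments : has_moments P (first_value h X).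
Variables (j : nat) (Z : T -> R).
Hypothesis jr : (j <= r)%N.
Hypothesis Z_version : cond_exp_version P (filtration_of X j) (first_value h X) Z.
Hypothesis Z0 : {ae P, forall w, Z w = 0}.

Lemma filtration_sub_others k : (j <= k)%N ->
  filtration_of X j `<=` <<s others X k >>.
Proof.
move=> jk; apply: smallest_sub.
  exact: (@sigma_algebra_measurable _ (g_sigma_algebraType (others X k))).
rewrite -bigcup_seq => A [i _ [B mB <-]].
have := @others_X _ _ T S X k i; apply => //.
by rewrite neq_ltn (leq_trans (ltn_ord i) jk).
Qed.

Lemma filtration_measurable A : filtration_of X j A -> measurable A.
Proof. by move=> /(filtration_sub_others (leqnn j)); exact: others_sub. Qed.

Lemma integral_first_value_eq0 A : filtration_of X j A ->
  \int[P]_w (\1_A w * first_value h X w) = 0.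
Proof.
move=> FA; have mA := filtration_measurable FA; have [_ iZ EZ] := Z_version.
rewrite /Rintegral.
transitivity (fine (\int[P]_(w in A) (first_value h X w)%:E)).
  congr fine; rewrite [RHS]integral_mkcond; apply: eq_integral => w _.
  by rewrite patchE indicE; case: ifPn => _; rewrite ?mul1r ?mul0r.
rewrite -EZ// (ae_eq_integral (cst 0%E))//.
- by rewrite integral0.
- by apply/measurable_funTS; exact: (measurable_int P).
- by apply: filterS Z0 => w /= -> _.
Qed.

Lemma indic_moments A : measurable A -> has_moments P (\1_A : T -> R).
Proof.
move=> mA; apply: (@has_moments_bounded _ _ _ _ _ 1); first exact: measurable_indic.
by move=> w; rewrite indicE ger0_norm//; case: (_ \in _).
Qed.

Lemma indic_insensitive k A : (j <= k)%N -> filtration_of X j A ->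
  insensitive (others X) k (\1_A : T -> R).
Proof. by move=> jk FA; apply: measurable_indic; exact: filtration_sub_others FA. Qed.

Lemma integral_proj_eq0 n A : (j <= n <= r)%N -> filtration_of X j A ->
  \int[P]_w (\1_A w * kproj P X h (iota 0 n) w) = 0.
Proof.
move=> + FA; have mA := filtration_measurable FA.
have [m] := ubnP (r - n); elim: m n => // m IH n nm /andP[jn nr].
have [nr'|] := ltnP n r; last first.
  move=> rn; rewrite (_ : n = r); last by apply/eqP; rewrite eqn_leq nr rn.
  under eq_Rintegral do rewrite proj_first.
  exact: integral_first_value_eq0.
have mom l : (size l <= r)%N -> uniq l -> has_moments P (kproj P X h l).
  exact: proj_moments.
have nn : n \notin iota 0 n by rewrite mem_iota add0n ltnn andbF.
rewrite -(@proj_orthogonal _ _ _ _ _ _ _ _ _ mX X_iid mh n (iota 0 n)); last 6 first.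
- by rewrite size_iota.
- exact: nn.
- by apply: mom; rewrite /= ?size_iota// nn iota_uniq.
- by apply: mom; rewrite ?size_iota// iota_uniq.
- exact: indic_insensitive.
- exact: indic_moments.
rewrite -[RHS](IH n.+1); last 2 first.
- by rewrite -(subnSK nr') in nm.
- by rewrite nr' (leq_trans jn).
apply: eq_Rintegral => w _; congr (_ * _); apply: proj_perm => //.
by rewrite -addn1 iotaD /= add0n cats1 perm_sym perm_rcons.
Qed.

Lemma proj_iota_null : \int[P]_w `|kproj P X h (iota 0 j) w| = 0.
Proof.
set y := kproj _ _ _ _.
have my : measurable_fun (setT : set (g_sigma_algebraType
    (\big[setU/set0]_(i < j) preimage_set_system setT (X i) measurable))) y.
  apply/measurable_EFinP.
  apply: (@seq_measurable_map _ S R (iota 0 j) (EFin \o marginal P X h (r - size (iota 0 j))) _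
    (g_sigma_algebraType _) X).
    have := @marginal_measurable _ _ _ _ _ P X r h mX mh (r - size (iota 0 j)).
    by rewrite subKn size_iota// leq_subr => /(_ isT).
  move=> k; rewrite mem_iota add0n => /= kj _ A mA; rewrite setTI.
  apply: sub_sigma_algebra; rewrite -bigcup_seq; exists (Ordinal kj) => /=.
    by rewrite mem_index_enum.
  by exists A => //; rewrite setTI.
have FA (B : set R) : measurable B -> filtration_of X j (y @^-1` B).
  by move=> mB; have := my measurableT B mB; rewrite setTI.
have jjr : (j <= j <= r)%N by rewrite leqnn.
have F1 := FA `]0, +oo[%classic (measurable_itv _).
have F2 := FA `]-oo, 0[%classic (measurable_itv _).
have m1 := indic_moments (filtration_measurable F1).
have m2 := indic_moments (filtration_measurable F2).
have yr : has_moments P y by apply: proj_moments => //; rewrite ?size_iota// iota_uniq.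
rewrite (@eq_Rintegral _ _ _ _ _ (fun w =>
  \1_(y @^-1` `]0, +oo[%classic) w * y w + (-1) * (\1_(y @^-1` `]-oo, 0[%classic) w * y w))).
  rewrite RintegralDm; [|exact: has_moments_mul|]; last first.
    exact/has_moments_scale/has_moments_mul.
  rewrite RintegralZm; last exact: has_moments_mul.
  by rewrite !integral_proj_eq0// mulr0 addr0.
move=> w _; rewrite !indicE.
have [yw|yw|yw] := ltgtP (y w) 0.
- rewrite memNset/=; last by rewrite in_itv /= ltNge (ltW yw).
  by rewrite mem_set/= ?in_itv/= ?yw// ltr0_norm//; lra.
- rewrite mem_set/=; last by rewrite in_itv /= yw.
  by rewrite memNset/= ?in_itv/= ?ltNge ?(ltW yw)// gtr0_norm//; lra.
- by rewrite yw normr0 !mulr0 addr0.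
Qed.

Lemma degenerate_proj_null q l : (0 < q)%N -> (size l <= j)%N -> uniq l ->
  \int[P]_w (kproj P X h l w ^+ q.*2) = 0.
Proof.
move=> q0 lj ul; suff H : (\int[P]_w (kproj P X h l w ^+ q.*2)%:E <= 0)%E.
  rewrite /Rintegral; suff -> : (\int[P]_w (kproj P X h l w ^+ q.*2)%:E = 0)%E by [].
  apply/eqP; rewrite eq_le H /= integral_ge0// => w _.
  by rewrite lee_fin expr_dbl_ge0.
have [n] := ubnP (j - size l); elim: n l lj ul => // n IH l lj ul ln.
have [lj'|] := ltnP (size l) j; last first.
  move=> jl; rewrite (@proj_law _ _ _ _ _ P X r h mX X_iid mh q l (iota 0 j))//; last 3 first.
  - by rewrite (leq_trans lj).
  - by rewrite size_iota; apply/eqP; rewrite eqn_leq jl lj.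
  - exact: iota_uniq.
  have yr : has_moments P (kproj P X h (iota 0 j)).
    by apply: proj_moments => //; rewrite ?size_iota// iota_uniq.
  have : (\int[P]_w `|(EFin \o kproj P X h (iota 0 j)) w| = 0)%E.
    have iabs : P.-integrable setT (fun w => `|(EFin \o kproj P X h (iota 0 j)) w|)%E.
      exact/integrable_abse/has_moments_int.
    rewrite -[LHS]fineK; last exact: integrable_fin_num.
    by have := proj_iota_null; rewrite /Rintegral => ->.
  have [myr _] := yr.
  have myE : measurable_fun setT (EFin \o kproj P X h (iota 0 j)) by exact/measurable_EFinP.
  move=> /(ae_eq_integral_abs P measurableT myE) ae0.
  rewrite (ae_eq_integral (cst 0%E))//; first by rewrite integral0.
    by apply/measurable_EFinP; exact: measurable_funX.
  apply: filterS ae0 => w /= H /H -[->].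
  by rewrite expr0n double_eq0 (gtn_eqF q0).
have [k kl] := exists_notin l.
have lr : (size l < r)%N by rewrite (leq_trans lj').
apply: le_trans (proj_contraction mX X_iid mh q0 lr kl) _.
by apply: IH; rewrite /= ?kl// -(subnSK lj') in ln *.
Qed.

End degeneracy.

(** * Hoeffding decomposition *)

Section subset_sums.
Variable I : finType.
Implicit Types A B J D : {set I}.

Lemma sum_toggle (V : zmodType) (k : I) (Q : pred {set I}) (f : {set I} -> V) :
  (forall J, k \notin J -> Q (k |: J) = Q J) ->
  (forall J, k \notin J -> Q J -> f (k |: J) = - f J) ->
  \sum_(J | Q J) f J = 0.
Proof.
move=> Qk fk; rewrite (bigID (fun J : {set I} => k \in J)) /=.
rewrite (reindex_onto (fun J => k |: J) (fun J => J :\ k)) /=; last first.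
  by move=> J /andP[_ kJ]; rewrite finset.setD1K.
rewrite (eq_bigl (fun J => Q J && (k \notin J))) => [|J]; last first.
  have [kJ|kJ] := boolP (k \in J).
    rewrite andbF; apply/negbTE/negP => /andP[_ /eqP E].
    by move: kJ; rewrite -E !inE eqxx.
  by rewrite setU11 Qk// finset.setU1K// eqxx !andbT.
by rewrite -big_split big1// => J /andP[QJ kJ] /=; rewrite fk// addNr.
Qed.

Lemma moebius_inversion (V : zmodType) (f : {set I} -> V) (B : {set I}) :
  \sum_(J : {set I} | J \subset B) \sum_(A : {set I} | A \subset J)
    (if odd #|J :\: A| then - f A else f A) = f B.
Proof.
rewrite (exchange_big_dep (fun A : {set I} => A \subset B)) /=; last first.
  by move=> J A JB AJ; exact: fintype.subset_trans JB.
rewrite (bigD1 B) ?fintype.subxx//= [X in _ + X]big1 ?addr0; last first.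
  move=> A /andP[AB AnB].
  have /fintype.subsetPn[k kB kA] : ~~ (B \subset A).
    by apply: contra AnB => BA; rewrite finset.eqEsubset AB BA.
  apply: (@sum_toggle _ k) => J kJ.
    rewrite finset.subUset finset.sub1set kB /=; congr (_ && _).
    apply/idP/idP => AJ; last by apply: fintype.subset_trans AJ _; exact: subsetU1.
    apply/fintype.subsetP => i iA; have := fintype.subsetP AJ i iA.
    by rewrite !inE => /predU1P[ik|//]; rewrite -ik iA in kA.
  move=> _; rewrite (_ : (k |: J) :\: A = k |: (J :\: A)); last first.
    apply/setP => i; rewrite !inE; case: eqP => [->|//]; by rewrite kA.
  rewrite cardsU1 !inE (negbTE kJ) andbF /=.
  by case: odd => //=; rewrite opprK.
rewrite (big_pred1 B) => [|J]; last by rewrite /= finset.eqEsubset andbC.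
by rewrite finset.setDv cards0.
Qed.

Lemma card_supersets (J B : {set I}) r : J \subset B -> (#|J| <= r)%N ->
  #|[set D : {set I} | [&& J \subset D, D \subset B & #|D| == r]]%SET| =
  'C(#|B| - #|J|, r - #|J|).
Proof.
move=> JB Jr; rewrite -(finset.cardsDS JB) -cards_draws.
rewrite -[RHS](card_in_imset (f := fun D => J :|: D)) => [|D1 D2]; last first.
  rewrite !inE => /andP[D1B _] /andP[D2B _] E.
  have key D : D \subset B :\: J -> (J :|: D) :\: J = D.
    move=> DB; apply/setP => i; rewrite !inE.
    have [iD|iD] := boolP (i \in D); last by rewrite orbF andNb.
    by have := fintype.subsetP DB i iD; rewrite !inE => /andP[-> _]; rewrite orbT.
  by rewrite -(key _ D1B) -(key _ D2B) E.
congr #|pred_of_set _|; apply/setP => D; rewrite inE.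
apply/idP/imsetP => [/and3P[JD DB Dr]|[E]].
  exists (D :\: J); last by rewrite -{1}(finset.setID D J) (finset.setIidPr JD).
  rewrite inE finset.setSD//= finset.cardsDS// (eqP Dr) eqxx//.
rewrite inE => /andP[EB /eqP Er] ->.
rewrite finset.subsetUl finset.subUset JB /=.
rewrite (fintype.subset_trans EB (finset.subsetDl _ _)) /=.
rewrite finset.cardsU (_ : J :&: E = finset.set0) ?cards0 ?subn0 ?Er ?subnKC//.
apply/setP => i; rewrite !inE; apply/negbTE/negP => /andP[iJ iE].
by have := fintype.subsetP EB i iE; rewrite !inE iJ.
Qed.

End subset_sums.

Section hoeffding.
Context d d' (T : measurableType d) (S : measurableType d') (R : realType)
  (P : probability T R) (X : nat -> T -> S) (r : nat) (h : r.-tuple S -> R).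
Hypothesis mX : forall k, measurable_fun setT (X k).
Hypothesis X_iid : iid P X.
Hypothesis mh : measurable_fun setT h.
Hypothesis h_sym : symmetric_kernel h.
Hypothesis Y_moments : has_moments P (first_value h X).
Variable N : nat.
Implicit Types A B J : {set 'I_N}.

Definition indices A : seq nat := map val (enum A).

Lemma size_indices A : size (indices A) = #|A|.
Proof. by rewrite size_map cardE. Qed.

Lemma indices_uniq A : uniq (indices A).
Proof. by rewrite map_inj_uniq ?enum_uniq//; exact: val_inj. Qed.

Lemma mem_indices A (k : 'I_N) : ((k : nat) \in indices A) = (k \in A).
Proof. by rewrite mem_map ?mem_enum//; exact: val_inj. Qed.

Lemma indices_setU1 A (k : 'I_N) : k \notin A ->
  perm_eq (indices (k |: A)) ((k : nat) :: indices A).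
Proof.
move=> kA; rewrite -[_ :: indices A]/(map val (k :: enum A)); apply: perm_map.
apply: uniq_perm; rewrite ?enum_uniq//= ?mem_enum ?kA ?enum_uniq// => i.
by rewrite mem_enum !inE mem_enum.
Qed.

Definition set_proj A (w : T) : R :=
  if (#|A| <= r)%N then kproj P X h (indices A) w else 0.

(* The component of [h] along [J] in the Hoeffding decomposition *)
Definition component J (w : T) : R :=
  if (#|J| <= r)%N then
    \sum_(A : {set 'I_N} | A \subset J)
      (if odd #|J :\: A| then - set_proj A w else set_proj A w)
  else 0.

Lemma set_proj_moments A : has_moments P (set_proj A).
Proof.
rewrite /set_proj; case: leqP => Ar; last exact: has_moments_cst.
by apply: proj_moments; rewrite ?size_indices ?indices_uniq.
Qed.

Lemma component_moments J : has_moments P (component J).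
Proof.
rewrite /component; case: leqP => Jr; last exact: has_moments_cst.
apply: has_moments_sum => A _; case: odd; last exact: set_proj_moments.
exact/has_moments_opp/set_proj_moments.
Qed.

Lemma set_proj_insensitive A (k : 'I_N) :
  k \notin A -> insensitive (others X) k (set_proj A).
Proof.
move=> kA; rewrite /set_proj; case: leqP => Ar; last exact: measurable_cst.
by apply: proj_insensitive; rewrite ?size_indices ?mem_indices.
Qed.

Lemma component_insensitive J (k : 'I_N) :
  k \notin J -> insensitive (others X) k (component J).
Proof.
move=> kJ; rewrite /component; case: leqP => Jr; last exact: measurable_cst.
apply: insensitive_sum => A AJ.
have kA : k \notin A by apply: contra kJ; exact: (fintype.subsetP AJ).
case: odd; last exact: set_proj_insensitive.
exact: (measurable_funN (set_proj_insensitive kA)).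
Qed.

Lemma set_proj_orthogonal A (k : 'I_N) phi : k \notin A -> (#|A| < r)%N ->
  insensitive (others X) k phi -> has_moments P phi ->
  \int[P]_w (phi w * set_proj (k |: A) w) = \int[P]_w (phi w * set_proj A w).
Proof.
move=> kA Ar iphi mphi; rewrite /set_proj cardsU1 kA add1n Ar (ltnW Ar).
have Alr : (size (indices A) < r)%N by rewrite size_indices.
have kl : (k : nat) \notin indices A by rewrite mem_indices.
rewrite -(@proj_orthogonal _ _ _ _ _ _ _ _ _ mX X_iid mh k (indices A))//.
- by apply: eq_Rintegral => w _; congr (_ * _); apply/proj_perm => //; exact: indices_setU1.
- by apply: proj_moments => //=; rewrite kl indices_uniq.
- by apply: proj_moments; rewrite ?indices_uniq// ltnW.
Qed.

Lemma component_orthogonal J (k : 'I_N) phi : k \in J ->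
  insensitive (others X) k phi -> has_moments P phi ->
  \int[P]_w (phi w * component J w) = 0.
Proof.
move=> kJ iphi mphi; rewrite /component; case: leqP => Jr; last first.
  by under eq_Rintegral do rewrite mulr0; exact: (Rintegral_cst1 P 0).
have mterm A : has_moments P (fun w => phi w * set_proj A w).
  by apply: has_moments_mul => //; exact: set_proj_moments.
transitivity (\sum_(A : {set 'I_N} | A \subset J)
   (if odd #|J :\: A| then - \int[P]_w (phi w * set_proj A w)
    else \int[P]_w (phi w * set_proj A w))).
  under eq_Rintegral do rewrite mulr_sumr.
  rewrite Rintegral_summ => [|A AJ].
    apply: eq_bigr => A _; case: odd => //.
    under eq_Rintegral do rewrite mulrN -mulN1r.
    by rewrite RintegralZm// mulN1r.
  apply: has_moments_mul => //; case: odd; last exact: set_proj_moments.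
  exact/has_moments_opp/set_proj_moments.
apply: (@sum_toggle _ _ k) => A kA.
  by rewrite finset.subUset finset.sub1set kJ.
move=> AJ; have Ar : (#|A| < r)%N.
  apply: leq_trans Jr; apply: proper_card; rewrite fintype.properE AJ /=.
  by apply: contra kA => /fintype.subsetP; exact.
rewrite set_proj_orthogonal//.
have -> : #|J :\: A| = #|J :\: (k |: A)|.+1.
  have -> : J :\: A = k |: (J :\: (k |: A)).
    apply/setP => i; rewrite !inE; case: eqP => [->|//]; by rewrite kA kJ.
  by rewrite cardsU1 !inE eqxx.
by rewrite /=; case: odd => //=; rewrite opprK.
Qed.

Lemma component_moment_le (q : nat) (c : R) J : (0 < q)%N -> 0 <= c ->
  (forall A, A \subset J -> \int[P]_w (set_proj A w ^+ q.*2) <= c ^+ q) ->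
  \int[P]_w (component J w ^+ q.*2) <= (4 ^+ #|J| * c) ^+ q.
Proof.
move=> q0 c0 Ac.
have J0 : 0 <= (4 ^+ #|J| * c) ^+ q by rewrite exprn_ge0// mulr_ge0// exprn_ge0.
rewrite /component; case: leqP => Jr; last first.
  rewrite (_ : Rintegral _ _ _ = 0)// expr0n double_eq0 (gtn_eqF q0).
  exact: (Rintegral_cst1 P 0).
pose f A w := if A \subset J then `|set_proj A w| else 0.
have mf A : has_moments P (f A).
  rewrite /f; case: (A \subset J); last exact: has_moments_cst.
  have [ms _] := set_proj_moments A.
  apply: has_moments_dominated; first exact: measurableT_comp.
  move=> m; exists (fun w => set_proj A w ^+ m.*2).
    by have [_] := set_proj_moments A; exact.
  by move=> w; rewrite -normrX ger0_norm// expr_dbl_ge0.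
have f0 A w : 0 <= f A w by rewrite /f; case: ifP.
have cE : Num.sqrt c ^+ q.*2 = c ^+ q by rewrite expr_dbl sqr_sqrtr.
have fc A : \int[P]_w (f A w ^+ q.*2) <= Num.sqrt c ^+ q.*2.
  rewrite cE /f; case AJ: (A \subset J); last first.
    rewrite (_ : Rintegral _ _ _ = 0) ?exprn_ge0// expr0n double_eq0 (gtn_eqF q0).
    exact: (Rintegral_cst1 P 0).
  under eq_Rintegral do rewrite -normrX ger0_norm ?expr_dbl_ge0//.
  exact: Ac.
have n0 : (0 < q.*2)%N by rewrite double_gt0.
have := Rintegral_sum_power (enum (finset.powerset J)) (sqrtr_ge0 c) n0 mf f0 fc.
rewrite -cardE finset.card_powerset exprMn cE natrX => H.
rewrite (_ : (4 ^+ #|J| * c) ^+ q = 2 ^+ #|J| ^+ q.*2 * c ^+ q); last first.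
  rewrite (exprMn q (4 ^+ _)) (_ : 4 = 2 ^+ 2 :> R); last by rewrite -natrX.
  by rewrite -!exprM; congr (_ ^+ _ * _); lia.
apply: le_trans H.
apply: Rintegral_ler.
- apply: has_moments_exp; apply: has_moments_sum => A _; case: odd; last exact: set_proj_moments.
  exact/has_moments_opp/set_proj_moments.
- by apply/has_moments_exp/has_moments_sum.
move=> w; rewrite -[leLHS]ger0_norm ?expr_dbl_ge0// normrX lerXn2r ?nnegrE ?sumr_ge0//.
apply: le_trans (ler_norm_sum _ _ _) _.
rewrite big_enum /= [leRHS](eq_bigl (fun A => A \subset J)) => [|A]; last first.
  by rewrite finset.powersetE.
by apply: ler_sum => A AJ; rewrite /f AJ; case: odd; rewrite ?normrN.
Qed.

Lemma sum_components (B : {set 'I_N}) w : (#|B| <= r)%N ->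
  \sum_(J : {set 'I_N} | J \subset B) component J w = set_proj B w.
Proof.
move=> Br; rewrite -(moebius_inversion (fun A => set_proj A w) B).
apply: eq_bigr => J JB; rewrite /component ifT//.
exact: leq_trans (subset_leq_card JB) Br.
Qed.


Definition homogeneous (j n : nat) (w : T) : R :=
  \sum_(J : {set 'I_N} | (#|J| == j) && (J \subset [set i : 'I_N | (i < n)%N]%SET))
    component J w.

Lemma sorted_indices A : sorted ltn (indices A).
Proof.
apply: (@subseq_sorted _ ltn ltn_trans _ (iota 0 N)); last exact: iota_ltn_sorted.
rewrite -val_enum_ord; apply: map_subseq.
rewrite {1}/enum_mem; rewrite [enum 'I_N]enumT; exact: filter_subseq.
Qed.

Lemma indices_inj : injective indices.
Proof.
by move=> A B AB; apply/setP => k; rewrite -!mem_indices AB.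
Qed.

Let bounded_seq n (l : seq nat) : all (fun k => (k < n)%N) l ->
  exists s : seq 'I_n, l = map val s.
Proof.
elim: l => [|k l IH] /=; first by exists [::].
by move=> /andP[kn /IH[s ->]]; exists (Ordinal kn :: s).
Qed.

Lemma Ustat_set_proj n w : (n <= N)%N ->
  Ustat h X n w = \sum_(B : {set 'I_N} | (B \subset [set i : 'I_N | (i < n)%N]%SET)
    && (#|B| == r)) set_proj B w.
Proof.
move=> nN; pose Phi l := seq_kernel h (map (X^~ w) l).
pose Q1 (s : r.-tuple 'I_n) := sorted ltn (map val s).
pose Q2 (B : {set 'I_N}) := (B \subset [set i : 'I_N | (i < n)%N]%SET) && (#|B| == r).
transitivity (\sum_(l <- [seq map val (val s) | s <- enum Q1]) Phi l).
  rewrite big_map big_enum /=; apply: eq_big => // s _.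
  rewrite -seq_kernel_tuple; congr seq_kernel.
  transitivity (map (fun k : 'I_n => X k w) (map (tnth s) (enum 'I_r))).
    by rewrite -map_comp.
  by rewrite map_tnth_enum -map_comp.
transitivity (\sum_(l <- [seq indices B | B <- enum Q2]) Phi l); last first.
  rewrite big_map big_enum /=; apply: eq_bigr => B /andP[_ /eqP Br].
  by rewrite /set_proj Br leqnn /kproj size_indices Br subnn.
apply: perm_big; apply: uniq_perm.
- rewrite map_inj_uniq ?enum_uniq// => s s' /(inj_map val_inj) E; exact: val_inj.
- by rewrite map_inj_uniq ?enum_uniq//; exact: indices_inj.
move=> l; apply/mapP/mapP => [[s + ->]|[B + ->]].
  rewrite mem_enum => sQ; pose B := [set i : 'I_N | (i : nat) \in map val s]%SET.
  have memB k : (k \in indices B) = (k \in map val s).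
    apply/mapP/idP => [[i + ->]|ks]; first by rewrite mem_enum inE.
    have /mapP[i si ki] := ks; have kN : (k < N)%N by rewrite ki (leq_trans (ltn_ord i)).
    by exists (Ordinal kN) => //; rewrite mem_enum inE.
  have E : indices B = map val s.
    apply: (irr_sorted_eq ltn_trans ltnn); [exact: sorted_indices|exact: sQ|exact: memB].
  exists B => //; rewrite mem_enum; apply/andP; split.
    apply/fintype.subsetP => i; rewrite !inE => /mapP[i' _ ->]; exact: ltn_ord.
  by rewrite -size_indices E size_map size_tuple.
rewrite mem_enum => /andP[Bn /eqP Br].
have [|s E] := @bounded_seq n (indices B).
  apply/allP => _ /mapP[i + ->]; rewrite mem_enum => /(fintype.subsetP Bn).
  by rewrite inE.
have ss : size s == r by rewrite -Br -size_indices E size_map.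
exists (Tuple ss) => //; rewrite mem_enum; rewrite unfold_in /Q1 /= -E.
exact: sorted_indices.
Qed.

Lemma Ustat_decomposition n w : (n <= N)%N ->
  Ustat h X n w = \sum_(j < r.+1) 'C(n - j, r - j)%:R * homogeneous j n w.
Proof.
move=> nN; rewrite Ustat_set_proj//.
set b := [set i : 'I_N | (i < n)%N]%SET.
have cb : #|b| = n.
  have inj : injective (widen_ord nN) by move=> i k [ik]; apply: val_inj.
  rewrite /b -[RHS](card_ord n) -(card_imset _ inj).
  congr #|pred_of_set _|; apply/setP => i; rewrite inE; apply/idP/imsetP => [ik|[k _ ->]].
    by exists (Ordinal ik) => //; apply: val_inj.
  by rewrite /= ltn_ord.
transitivity (\sum_(B : {set 'I_N} | (B \subset b) && (#|B| == r))
    \sum_(J : {set 'I_N} | J \subset B) component J w).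
  by apply: eq_bigr => B /andP[_ /eqP Br]; rewrite sum_components// Br.
rewrite (exchange_big_dep (fun J : {set 'I_N} => (#|J| <= r)%N && (J \subset b))) /=; last first.
  move=> B J /andP[Bb /eqP <-] JB.
  by rewrite subset_leq_card//= (fintype.subset_trans JB).
rewrite (partition_big (fun J : {set 'I_N} => inord #|J| : 'I_r.+1) xpredT)//=.
apply: eq_bigr => j _; rewrite mulr_sumr.
rewrite [RHS](eq_bigl (fun J : {set 'I_N} => ((#|J| <= r)%N && (J \subset b))
    && (inord #|J| == j))) => [|J]; last first.
  rewrite -/b; have [Jr|Jr] := leqP #|J| r; last first.
    rewrite /= (_ : (#|J| == j) = false)//; apply/eqP => E.
    by have := ltn_ord j; rewrite -E ltnS leqNgt Jr.
  rewrite /= andbC; congr (_ && _).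
  by rewrite -val_eqE /= inordK.
apply: eq_bigr => J /andP[/andP[Jr Jb] /eqP Jj].
rewrite sumr_const -[LHS]mulr_natl; congr (_%:R * _).
have -> : j = #|J| :> nat by rewrite -Jj inordK.
rewrite -cb -card_supersets//; apply: eq_card => B; rewrite !inE.
by rewrite unfold_in /= andbC.
Qed.

End hoeffding.

(** * Maximal deviations *)

Lemma bin_fact_le n m : ('C(n, m) * m`! <= n ^ m)%N.
Proof.
rewrite bin_ffact; elim: m n => [|m IH] n; first by rewrite ffactn0.
rewrite ffactnS expnS leq_mul2l (leq_trans (IH _)) ?orbT//.
by case: (m) => // e; rewrite leq_exp2r// leq_pred.
Qed.

Section maximal_deviation.
Context d d' (T : measurableType d) (S : measurableType d') (R : realType)
  (P : probability T R) (X : nat -> T -> S) (r : nat) (h : r.-tuple S -> R).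
Hypothesis mX : forall k, measurable_fun setT (X k).
Hypothesis X_iid : iid P X.
Hypothesis mh : measurable_fun setT h.
Hypothesis h_sym : symmetric_kernel h.
Hypothesis Y_moments : has_moments P (first_value h X).
Variable N : nat.
Hypothesis rN : (r <= N)%N.
Hypothesis r_gt0 : (0 < r)%N.

Local Notation V := (@homogeneous _ _ _ _ _ P X r h N).
Local Notation comp := (@component _ _ _ _ _ P X r h N).

Let cmom J : has_moments P (comp J).
Proof. exact: component_moments. Qed.

Let cins (J : {set 'I_N}) (k : 'I_N) :
  k \notin J -> insensitive (others X) k (comp J).
Proof. exact: component_insensitive. Qed.

Let corth (J : {set 'I_N}) (k : 'I_N) phi : k \in J ->
  insensitive (others X) k phi -> has_moments P phi ->
  \int[P]_w (phi w * comp J w) = 0.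
Proof. exact: component_orthogonal. Qed.

Lemma homogeneous_moment_null (j q : nat) : (0 < q)%N ->
  (forall l, (size l <= j)%N -> uniq l ->
    \int[P]_w (kproj P X h l w ^+ q.*2) = 0) ->
  \int[P]_w ((\sum_(J : {set 'I_N} | #|J| == j) comp J w) ^+ q.*2) <= 0.
Proof.
move=> q0 H0; have q20 : (0 ^+ q = 0 :> R) by rewrite expr0n (gtn_eqF q0).
have := @even_moment_sum _ _ _ P N (others X) comp cmom cins corth q j 0 q0 (lexx 0).
rewrite mulr0 q20; apply=> J Jj.
have := @component_moment_le _ _ _ _ _ P X r h mX X_iid mh Y_moments N q 0 J q0 (lexx 0).
rewrite mulr0 q20; apply=> A AJ; rewrite /set_proj; case: leqP => Ar.
  rewrite H0 ?indices_uniq// size_indices -Jj.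
  exact: subset_leq_card.
rewrite expr0n double_eq0 (gtn_eqF q0) (_ : Rintegral _ _ _ = 0)//.
exact: (Rintegral_cst1 P 0).
Qed.

Lemma homogeneous_moment_le (i j q : nat) (c : R) : (0 < q)%N -> (i <= j)%N -> 0 <= c ->
  \int[P]_w (first_value h X w ^+ q.*2) <= c ^+ q ->
  \int[P]_w ((\sum_(J : {set 'I_N} | #|J| == j) comp J w) ^+ q.*2) <=
  (96 ^+ j / j`!%:R * (N%:R ^+ j.*2 / N%:R ^+ i) * q%:R ^+ i * c) ^+ q.
Proof.
move=> q0 ij c0 Yc.
have N0 : 0 < N%:R :> R by rewrite ltr0n (leq_trans r_gt0).
have jf : 0 < j`!%:R :> R by rewrite ltr0n fact_gt0.
have Cj : 'C(N, j)%:R <= N%:R ^+ j / j`!%:R :> R.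
  by rewrite ler_pdivlMr// -natrM -natrX ler_nat bin_fact_le.
have cJ (J : {set 'I_N}) : #|J| = j -> \int[P]_w (comp J w ^+ q.*2) <= (4 ^+ j * c) ^+ q.
  move=> <-; apply: component_moment_le => // A _; rewrite /set_proj.
  case: leqP => Ar; last first.
    rewrite expr0n double_eq0 (gtn_eqF q0) (_ : Rintegral _ _ _ = 0) ?exprn_ge0//.
    exact: (Rintegral_cst1 P 0).
  apply: le_trans Yc; apply: proj_moment_le => //.
    by rewrite size_indices.
  exact: indices_uniq.
have c40 : 0 <= 4 ^+ j * c by rewrite mulr_ge0// exprn_ge0.
have W0 : 0 <= 96 ^+ j / j`!%:R * (N%:R ^+ j.*2 / N%:R ^+ i) * q%:R ^+ i * c.
  by rewrite !mulr_ge0// ?invr_ge0 ?exprn_ge0// ltW.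
have [qN|Nq] := leqP q N.
  apply: le_trans (@even_moment_sum _ _ _ P N (others X) comp cmom cins corth q j
    (4 ^+ j * c) q0 c40 cJ) _.
  rewrite lerXn2r ?nnegrE// ?mulr_ge0 ?exprn_ge0 ?mulr_ge0//.
  have -> : 'C(N, j)%:R * (24 * q%:R) ^+ j * (4 ^+ j * c) =
      96 ^+ j * c * ('C(N, j)%:R * q%:R ^+ j).
    rewrite (exprMn j 24) (_ : 96 = 24 * 4 :> R) ?(exprMn j 24); first by ring.
    by rewrite -natrM.
  have -> : 96 ^+ j / j`!%:R * (N%:R ^+ j.*2 / N%:R ^+ i) * q%:R ^+ i * c =
      96 ^+ j * c * (N%:R ^+ j / j`!%:R * (q%:R ^+ i * N%:R ^+ (j - i))).
    rewrite -addnn exprD -{3}(subnK ij) [N%:R ^+ (_ + i)]exprD; field.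
    by rewrite expf_neq0 ?lt0r_neq0.
  rewrite ler_wpM2l ?mulr_ge0 ?exprn_ge0// ler_pM ?exprn_ge0//.
  rewrite -{1}(subnKC ij) exprD ler_wpM2l ?exprn_ge0//.
  by rewrite lerXn2r ?nnegrE ?ler_nat.
pose f (J : {set 'I_N}) w := if #|J| == j then `|comp J w| else 0.
have mf J : has_moments P (f J).
  rewrite /f; case: (#|J| == j); last exact: has_moments_cst.
  have [mc ic] := cmom J.
  apply: has_moments_dominated; first exact: measurableT_comp.
  move=> m; exists (fun w => comp J w ^+ m.*2); first exact: ic.
  by move=> w; rewrite -normrX ger0_norm// expr_dbl_ge0.
have f0 J w : 0 <= f J w by rewrite /f; case: ifP.
have cE : Num.sqrt (4 ^+ j * c) ^+ q.*2 = (4 ^+ j * c) ^+ q.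
  by rewrite expr_dbl sqr_sqrtr.
have fc J : \int[P]_w (f J w ^+ q.*2) <= Num.sqrt (4 ^+ j * c) ^+ q.*2.
  rewrite cE /f; case Jj: (#|J| == j); last first.
    rewrite (_ : Rintegral _ _ _ = 0) ?exprn_ge0// expr0n double_eq0 (gtn_eqF q0).
    exact: (Rintegral_cst1 P 0).
  under eq_Rintegral do rewrite -normrX ger0_norm ?expr_dbl_ge0//.
  exact/cJ/eqP.
have n0 : (0 < q.*2)%N by rewrite double_gt0.
pose Q (J : {set 'I_N}) := #|J| == j.
have := Rintegral_sum_power (enum Q) (sqrtr_ge0 (4 ^+ j * c)) n0 mf f0 fc.
rewrite -cardE (_ : #|Q| = 'C(N, j)); last first.
  by rewrite -[in RHS](card_ord N) -card_draws; apply: eq_card => J; rewrite inE.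
rewrite exprMn cE => H; apply: le_trans (le_trans H _).
  apply: Rintegral_ler.
  - by apply/has_moments_exp/has_moments_sum.
  - by apply/has_moments_exp/has_moments_sum.
  move=> w; rewrite -[leLHS]ger0_norm ?expr_dbl_ge0// normrX.
  rewrite lerXn2r ?nnegrE ?sumr_ge0//.
  apply: le_trans (ler_norm_sum _ _ _) _.
  rewrite big_enum /=.
  by apply: ler_sum => J Jj; rewrite /f Jj.
rewrite expr_dbl -exprMn lerXn2r ?nnegrE ?mulr_ge0 ?exprn_ge0//.
have -> : 96 ^+ j / j`!%:R * (N%:R ^+ j.*2 / N%:R ^+ i) * q%:R ^+ i * c =
   (N%:R ^+ j / j`!%:R * N%:R ^+ j) * (96 ^+ j * c * (q%:R ^+ i / N%:R ^+ i)).
  by rewrite -addnn exprD; ring.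
rewrite expr2 ler_pM ?mulr_ge0 ?exprn_ge0//.
  rewrite ler_pM//; apply: le_trans Cj _.
  by rewrite ler_pdivrMr// ler_peMr ?exprn_ge0// ler1n fact_gt0.
apply: (@le_trans _ _ (96 ^+ j * c)).
  by rewrite ler_wpM2r// lerXn2r ?nnegrE// ler_nat.
rewrite ler_peMr ?mulr_ge0 ?exprn_ge0// ler_pdivlMr ?exprn_gt0// mul1r.
by rewrite lerXn2r ?nnegrE ?ler_nat// ltnW.
Qed.

Lemma Ustat_measurable n : measurable_fun setT (Ustat h X n).
Proof.
rewrite /Ustat; under eq_fun do rewrite big_mkcond /=.
apply: measurable_sum => s; case: (sorted _ _) => //.
apply: measurableT_comp => //; apply/measurable_fun_tnthP => i.
rewrite (_ : _ \o _ = X (tnth s i)); first exact: mX.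
by apply/funext => w /=; rewrite tnth_mktuple.
Qed.

Lemma measurable_bigmax (s : seq nat) (Q : pred nat) (f : nat -> T -> R) :
  (forall n, measurable_fun setT (f n)) ->
  measurable_fun setT (fun w => \big[Num.max/0]_(n <- s | Q n) f n w).
Proof.
move=> mf; elim: s => [|n s IH].
  by under eq_fun do rewrite big_nil; exact: measurable_cst.
under eq_fun do rewrite big_cons.
by have [Qn|//] := boolP (Q n); apply: measurable_maxr.
Qed.

Lemma measurable_max_Ustat (c : R) :
  measurable [set w | c < \big[Num.max/0]_(r <= n < N.+1) `|Ustat h X n w|].
Proof.
rewrite -[X in measurable X]setTI.
have mmax := @measurable_bigmax (index_iota r N.+1) xpredT (fun n w => `|Ustat h X n w|).
have := measurable_fun_ltr (measurable_cst c)
  (mmax (fun n => measurableT_comp (@normr_measurable _ _) (@Ustat_measurable n))).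
by move=> H; apply: (H measurableT [set true]%classic).
Qed.

Lemma sum_half_powers m : \sum_(j < m) (2 ^+ j.+1)^-1 <= 1 :> R.
Proof.
suff -> : \sum_(j < m) (2 ^+ j.+1)^-1 = 1 - (2 ^+ m)^-1 :> R.
  by rewrite lerBlDr lerDl invr_ge0 exprn_ge0.
elim: m => [|m IH]; first by rewrite big_ord0 expr0 invr1 subrr.
by rewrite big_ord_recr /= IH exprS; field; rewrite expf_neq0.
Qed.

Lemma max_Ustat_tail (x : R) (q : nat) (b : nat -> R) : 0 < x -> (0 < q)%N ->
  (forall j, (j <= r)%N ->
    \int[P]_w ((\sum_(J : {set 'I_N} | #|J| == j) comp J w) ^+ q.*2) <= b j) ->
  (P [set w | (N%:R ^+ r * x <
      \big[Num.max/0]_(r <= n < N.+1) `|Ustat h X n w|)%R] <=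
   (\sum_(j < r.+1) b j / (N%:R ^+ j * x / 2 ^+ j.+1) ^+ q.*2)%:E)%E.
Proof.
move=> x0 q0 Vb.
have N0 : 0 < N%:R :> R by rewrite ltr0n (leq_trans r_gt0).
pose lam (j : nat) : R := N%:R ^+ j * x / 2 ^+ j.+1.
have lam0 j : 0 < lam j by rewrite divr_gt0 ?mulr_gt0 ?exprn_gt0.
pose E (j : nat) := [set w | exists2 n, (n <= N)%N & lam j < `|V j n w|].
have mE j : measurable (E j).
  exact: (measurable_exceedance cmom (fun J : {set 'I_N} => #|J| == j) (lam j)).
have PE (j : nat) : (j <= r)%N -> (P (E j) <= (b j / lam j ^+ q.*2)%:E)%E.
  move=> jr; have := exceedance_le cmom cins corth
    (fun J : {set 'I_N} => #|J| == j) q0 (lam0 j).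
  move=> /le_trans; apply.
  by rewrite lee_fin; apply: ler_wpM2r; rewrite ?invr_ge0 ?expr_dbl_ge0 ?Vb.
apply: (@le_trans _ _ (P (\big[setU/set0]_(j < r.+1) E j))).
  apply: le_measure; rewrite ?inE.
  - exact: measurable_max_Ustat.
  - by apply: bigsetU_measurable.
  move=> w /= Nx; rewrite -bigcup_mkord.
  have [n /andP[rn nN] Un] : exists2 n, (r <= n <= N)%N & N%:R ^+ r * x < `|Ustat h X n w|.
    apply: contrapT => H; move: Nx; rewrite ltNge => /negP; apply.
    rewrite big_seq; apply: bigmax_le => [|n]; first by rewrite mulr_ge0 ?exprn_ge0 ?ltW.
    rewrite mem_index_iota ltnS => nN; rewrite leNgt; apply/negP => Un.
    by apply: H; exists n.
  apply: contrapT => H; move: Un; rewrite ltNge => /negP; apply.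
  rewrite (@Ustat_decomposition _ _ _ _ _ P X r h N n w nN).
  apply: le_trans (ler_norm_sum _ _ _) _.
  apply: (@le_trans _ _ (\sum_(j < r.+1) N%:R ^+ r * x * (2 ^+ j.+1)^-1)); last first.
    by rewrite -mulr_sumr ler_piMr ?sum_half_powers// mulr_ge0 ?exprn_ge0 ?ltW.
  apply: ler_sum => j _; have jr : (j <= r)%N by rewrite -ltnS.
  rewrite normrM ger0_norm//.
  apply: (@le_trans _ _ (N%:R ^+ (r - j) * lam j)).
    rewrite ler_pM//.
      rewrite -natrX ler_nat (leq_trans (leq_pmulr _ (fact_gt0 (r - j))))//.
      rewrite (leq_trans (bin_fact_le _ _))//.
      by case: (r - j)%N => // e; rewrite leq_exp2r// (leq_trans (leq_subr _ _)).
    rewrite leNgt; apply/negP => lV; apply: H; exists j => //=.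
    by exists n.
  by rewrite /lam !mulrA -exprD subnK.
have := @Boole_inequality _ _ _ P E r.+1 (fun j _ => mE j).
move=> /le_trans; apply.
rewrite -sumEFin; apply: lee_sum => j _; apply: PE.
by rewrite -ltnS.
Qed.

End maximal_deviation.

(** * Exponential tails *)

Section exponential_tail.
Context d (T : measurableType d) (R : realType) (P : probability T R).
Variables (gamma M : R) (f : T -> R).
Hypothesis gamma_gt0 : 0 < gamma.
Hypothesis mf : measurable_fun setT f.
Hypothesis tailM : exp_tail_sup P gamma f = M%:E.

Let M' := Num.max 1 M.
Let u w := `|f w| `^ gamma.

Let M'1 : 1 <= M'. Proof. by rewrite le_max lexx. Qed.
Let M'0 : 0 <= M'. Proof. exact: le_trans ler01 M'1. Qed.

Let mu_ : measurable_fun setT u.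
Proof.
apply: (measurableT_comp (f := @powR R ^~ gamma)); first exact: measurable_powR.
exact: measurableT_comp.
Qed.

Lemma measurable_le_cst (c : R) : measurable [set w | c <= u w].
Proof.
rewrite -[X in measurable X]setTI.
have H := measurable_fun_ler (measurable_cst c) mu_.
by apply: (H measurableT [set true]%classic).
Qed.

Lemma prob_tail (t : R) : 0 < t ->
  (P [set w | (t < `|f w|)%R] <= (M * expR (- t `^ gamma))%:E)%E.
Proof.
move=> t0; set A := [set w | _].
have mA : measurable A.
  rewrite -[X in measurable X]setTI.
  have H := measurable_fun_ltr (measurable_cst t) (measurableT_comp (@normr_measurable R setT) mf).
  by apply: (H measurableT [set true]%classic).
have : ((expR (t `^ gamma))%:E * P A <= M%:E)%E.
  by rewrite -tailM; apply: ereal_sup_ubound; exists t.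
rewrite -[P A]fineK ?fin_num_measure// -EFinM !lee_fin expRN.
by rewrite ler_pdivlMr ?expR_gt0// mulrC.
Qed.

Lemma prob_power_ge (n : nat) :
  (P [set w | (n%:R <= u w)%R] <= (M' * expR (1 - n%:R))%:E)%E.
Proof.
have mn := measurable_le_cst n%:R.
have [n1|n1] := leqP n 1.
  apply: le_trans (probability_le1 P mn) _; rewrite lee_fin.
  apply: le_trans (M'1) _; rewrite ler_peMr//.
  rewrite -[leLHS]expR0 ler_expR subr_ge0.
  by rewrite -[leRHS]/(1%:R) ler_nat.
case: n n1 mn => [|[|m]] // _ mn.
pose t : R := m.+1%:R `^ gamma^-1.
have t0 : 0 < t by rewrite powR_gt0.
have tg : t `^ gamma = m.+1%:R by rewrite -powRrM mulVf ?gt_eqF// powRr1.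
apply: (@le_trans _ _ (P [set w | (t < `|f w|)%R])).
  apply: le_measure; rewrite ?inE//.
    rewrite -[X in measurable X]setTI.
    have H := measurable_fun_ltr (measurable_cst t)
      (measurableT_comp (@normr_measurable R setT) mf).
    by apply: (H measurableT [set true]%classic).
  move=> w /=; rewrite [in X in X -> _]leNgt => /negP H; rewrite ltNge; apply/negP => ft.
  apply: H; apply: (@le_lt_trans _ _ m.+1%:R); last by rewrite ltr_nat.
  by rewrite -tg /u ge0_ler_powR ?nnegrE// ltW.
apply: le_trans (prob_tail t0) _; rewrite lee_fin tg ler_pM ?expR_ge0//.
- rewrite -lee_fin -tailM; apply: ereal_sup_ge.
  exists ((expR (1 `^ gamma))%:E * P [set w | (1 < `|f w|)%R])%E.
    by exists 1 => //=.
  by rewrite mule_ge0// lee_fin expR_ge0.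
- by rewrite /M' le_max lexx orbT.
- by rewrite ler_expR -natr1; lra.
Qed.

Let z : R := expR (- 2^-1).
Let a : R := M' * expR (3 / 2).
(* The sum of the geometric series dominating the expectation of
   [exp (u / 2) <= sum_n exp ((n + 1) / 2) 1_(n <= u)]. *)
Definition exp_moment_bound : R := a / (1 - z).

Let z0 : 0 < z. Proof. exact: expR_gt0. Qed.
Let z1 : z < 1. Proof. by rewrite expR_lt1; lra. Qed.
Let a0 : 0 <= a. Proof. by rewrite mulr_ge0// expR_ge0. Qed.

Lemma exp_moment_le : (\int[P]_w (expR (u w / 2))%:E <= exp_moment_bound%:E)%E.
Proof.
pose g (n : nat) w : \bar R :=
  ((expR (n.+1%:R / 2))%:E * (\1_[set w | n%:R <= u w] w)%:E)%E.
have mg n : measurable_fun setT (g n).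
  apply: measurable_funeM; apply/measurable_EFinP.
  by apply: measurable_indic; exact: measurable_le_cst.
have g0 n w : (0 <= g n w)%E.
  by rewrite mule_ge0// lee_fin expR_ge0.
apply: (@le_trans _ _ (\int[P]_w \sum_(n <oo) g n w)%E).
  apply: ge0_le_integral => //.
  - apply/measurable_EFinP; apply: measurableT_comp => //.
    exact: measurable_funM.
  - by apply: ge0_emeasurable_sum.
  - move=> w _.
    have u0 : 0 <= u w by exact: powR_ge0.
    have /andP[nu un] := truncn_itv u0.
    apply: le_trans (nneseries_lim_ge (m := 0%N) (Num.truncn (u w)).+1 _); last by [].
    rewrite big_nat_recr//=; apply: (@le_trans _ _ (g (Num.truncn (u w)) w)).
      rewrite /g indicE mem_set// mule1 lee_fin ler_expR.
      by rewrite ler_wpM2r// ltW.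
    by rewrite leeDr// sume_ge0.
rewrite integral_nneseries//.
apply: lime_le; first by apply: is_cvg_nneseries => n _ _; exact: integral_ge0.
apply: nearW => n.
apply: (@le_trans _ _ (\sum_(0 <= i < n) (a * z ^+ i)%:E)%E).
  apply: lee_sum => i _.
  rewrite ge0_integralZl//; last first.
    by apply/measurable_EFinP; apply: measurable_indic; exact: measurable_le_cst.
  rewrite integral_indic//; last exact: measurable_le_cst.
  rewrite setIT.
  apply: (@le_trans _ _ ((expR (i.+1%:R / 2))%:E * (M' * expR (1 - i%:R))%:E)%E).
    by rewrite lee_wpmul2l ?prob_power_ge// lee_fin expR_ge0.
  rewrite -EFinM lee_fin /a /z -expRM_natl -mulrA -expRD mulrCA -expRD.
  by rewrite ler_wpM2l// ler_expR -natr1; lra.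
rewrite sumEFin lee_fin; apply: geometric_le_lim => //.
by rewrite ger0_norm// ltW.
Qed.

Lemma even_power_exp_bound (q : nat) (w : T) : (0 < q)%N ->
  f w ^+ q.*2 <= ((4 * q%:R / gamma) `^ (2 / gamma)) ^+ q * expR (u w / 2).
Proof.
move=> q0; rewrite -[leLHS]ger0_norm ?expr_dbl_ge0// normrX /u.
have [->|f0] := eqVneq `|f w| 0.
  by rewrite expr0n double_eq0 (gtn_eqF q0) mulr_ge0 ?expR_ge0 ?exprn_ge0 ?powR_ge0.
have fp : 0 < `|f w| by rewrite lt_neqAle eq_sym f0 normr_ge0.
have Q0 : 0 < q%:R :> R by rewrite ltr0n.
set k := 4 * q%:R / gamma; have k0 : 0 < k by rewrite divr_gt0// mulr_gt0.
have up : 0 < `|f w| `^ gamma by rewrite powR_gt0.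
rewrite -(ler_ln (x := _ ^+ q.*2)) ?posrE ?mulr_gt0 ?exprn_gt0 ?powR_gt0 ?expR_gt0//.
rewrite lnM ?posrE ?exprn_gt0 ?powR_gt0 ?expR_gt0// expRK !lnXn ?powR_gt0// ln_powR.
set v := `|f w| `^ gamma in up *.
have vE : ln v = gamma * ln `|f w| by rewrite ln_powR.
have := ln_sublinear (divr_gt0 up k0); rewrite ln_div ?posrE// vE.
move=> /ltW H.
have c0 : 0 <= 2 * q%:R / gamma by rewrite divr_ge0 ?mulr_ge0 ?ltW.
have := ler_wpM2l c0 H.
rewrite -(mulr_natl (ln `|f w|)) -(mulr_natl (2 / gamma * ln k)) -muln2 natrM.
have -> : 2 * q%:R / gamma * (gamma * ln `|f w| - ln k) =
  q%:R * 2 * ln `|f w| - q%:R * (2 / gamma * ln k).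
  by field; rewrite gt_eqF.
have -> : 2 * q%:R / gamma * (v / k) = v / 2.
  by rewrite /k; field; rewrite !gt_eqF.
by rewrite lerBlDl.
Qed.

Lemma exp_tail_moment (q : nat) : (0 < q)%N ->
  (\int[P]_w (f w ^+ q.*2)%:E <=
   (((4 * q%:R / gamma) `^ (2 / gamma)) ^+ q * exp_moment_bound)%:E)%E.
Proof.
move=> q0; set K := _ ^+ q; have K0 : 0 <= K by rewrite exprn_ge0 ?powR_ge0.
apply: (@le_trans _ _ (\int[P]_w (K%:E * (expR (u w / 2))%:E))%E).
  apply: ge0_le_integral => //.
  - by move=> w _; rewrite lee_fin expr_dbl_ge0.
  - by apply/measurable_EFinP; exact: measurable_funX.
  - apply: measurable_funeM; apply/measurable_EFinP; apply: measurableT_comp => //.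
    exact: measurable_funM.
  - by move=> w _; rewrite -EFinM lee_fin; exact: even_power_exp_bound.
rewrite ge0_integralZl//; last first.
  apply/measurable_EFinP; apply: measurableT_comp => //.
  exact: measurable_funM.
by rewrite EFinM lee_wpmul2l// exp_moment_le.
Qed.

Lemma exp_tail_has_moments : has_moments P f.
Proof.
apply: has_moments_dominated => // -[|m].
  exists (fun=> 1); first exact: finite_measure_integrable_cst.
  by move=> w; rewrite expr0.
exists (fun w => f w ^+ m.+1.*2) => //; apply/integrableP; split.
  by apply/measurable_EFinP; exact: measurable_funX.
under eq_integral do rewrite /= ger0_norm ?expr_dbl_ge0//.
by apply: le_lt_trans (exp_tail_moment (q := m.+1) _) _; rewrite ?ltry.
Qed.

Lemma exp_tail_Rmoment (q : nat) : (0 < q)%N ->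
  \int[P]_w (f w ^+ q.*2) <=
  ((4 * q%:R / gamma) `^ (2 / gamma)) ^+ q * exp_moment_bound.
Proof.
move=> q0; rewrite -lee_fin /Rintegral fineK; first exact: exp_tail_moment.
have [_ /(_ q.*2)] := exp_tail_has_moments; exact: integrable_fin_num.
Qed.

End exponential_tail.

(** * The deviation inequality *)

Lemma sum_exp_le (R : realType) (z : R) m : 0 <= z ->
  \sum_(j < m) z ^+ j / j`!%:R <= expR z.
Proof.
move=> z0; rewrite -(big_mkord xpredT (fun j => z ^+ j / j`!%:R)).
have nd : nondecreasing_seq (series (exp_coeff z)).
  by apply: nondecreasing_series => n _ _; exact: exp_coeff_ge0.
exact: (nondecreasing_cvgn_le nd (is_cvg_series_exp_coeff z) m).
Qed.

Lemma expr_superadditive (R : realFieldType) (a b : R) q : (0 < q)%N ->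
  0 <= a -> 0 <= b -> a ^+ q + b ^+ q <= (a + b) ^+ q.
Proof.
case: q => // q _ a0 b0; elim: q => [|q IH]; first by rewrite !expr1.
rewrite exprS [b ^+ _]exprS [X in _ <= X]exprS.
apply: le_trans (ler_wpM2l _ IH); last by rewrite addr_ge0.
have : 0 <= a * b ^+ q.+1 by rewrite mulr_ge0 ?exprn_ge0.
have : 0 <= b * a ^+ q.+1 by rewrite mulr_ge0 ?exprn_ge0.
move: (a ^+ q.+1) (b ^+ q.+1) => u v; rewrite mulrDl !mulrDr => H1 H2.
by rewrite addrACA -!addrA lerD2l; lra.
Qed.

Lemma sum_expr_le (R : realFieldType) (m q : nat) (a : nat -> R) : (0 < q)%N ->
  (forall j, 0 <= a j) ->
  \sum_(j < m) a j ^+ q <= (\sum_(j < m) a j) ^+ q.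
Proof.
move=> q0 a0; elim: m => [|m IH].
  by rewrite !big_ord0 exprn_ge0.
rewrite !big_ord_recr /=; apply: le_trans (expr_superadditive q0 _ _).
- by rewrite lerD2r.
- by apply: sumr_ge0.
- exact: a0.
Qed.

Lemma optimize_moment_order (R : realType) (p D y s : R) :
  0 <= p <= 1 -> 0 <= D -> 0 < y -> 1 <= s ->
  (forall q, (0 < q)%N -> p <= (D * q%:R `^ s / y) ^+ q) ->
  p <= expR 1 * expR (- (Num.max 1 (expR 1 * D))^-1 * y `^ s^-1).
Proof.
move=> /andP[p0 p1] D0 y0 s1 H.
set D' := Num.max _ _.
have D'1 : 1 <= D' by rewrite le_max lexx.
have D'0 : 0 < D' by rewrite (lt_le_trans ltr01).
have D'D : expR 1 * D <= D' by rewrite le_max lexx orbT.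
have s0 : 0 < s by rewrite (lt_le_trans ltr01).
have v0 : 0 < y / D' by rewrite divr_gt0.
pose t := (y / D') `^ s^-1.
have t0 : 0 <= t by exact: powR_ge0.
have ty : D'^-1 * y `^ s^-1 <= t.
  rewrite /t mulrC powRM ?invr_ge0; [|exact: ltW|exact: ltW].
  apply: ler_wpM2l; first exact: powR_ge0.
  by apply: ger1_powR; rewrite ?invr_gt0 ?D'0 ?invf_le1.
apply: (@le_trans _ _ (expR 1 * expR (- t))); last first.
  by rewrite ler_wpM2l ?expR_ge0// ler_expR mulNr lerN2.
rewrite -expRD; have [t1|t1] := ltP t 1.
  apply: (le_trans p1); rewrite -[leLHS]expR0 ler_expR; lra.
have q0 : (0 < Num.truncn t)%N by rewrite truncn_gt0.
have /andP[qt tq] := truncn_itv t0.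
apply: (le_trans (H _ q0)); set q := Num.truncn t in q0 qt tq *.
apply: (@le_trans _ _ (expR (-1) ^+ q)); last first.
  by rewrite -expRM_natl ler_expR -natr1 in tq *; lra.
have qs : q%:R `^ s <= y / D'.
  apply: (@le_trans _ _ (t `^ s)); first by rewrite ge0_ler_powR ?nnegrE// ltW.
  by rewrite /t -powRrM mulVf ?gt_eqF// powRr1// ltW.
have y0' := ltW y0.
rewrite lerXn2r ?nnegrE ?divr_ge0 ?mulr_ge0 ?powR_ge0 ?expR_ge0//.
rewrite ler_pdivrMr//; apply: le_trans (ler_wpM2l D0 qs) _.
have -> : D * (y / D') = D / D' * y by rewrite mulrCA mulrC.
apply: ler_wpM2r; first exact: ltW.
by rewrite expRN ler_pdivrMr// ler_pdivlMl ?expR_gt0.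
Qed.

Theorem theorem1p13 (R : realType) (gamma M : R) (gamma_gt0 : 0 < gamma) :
  exists K1 K2 : R, [/\ 0 < K1, 0 < K2 &
    forall (d d' : measure_display) (T : measurableType d)
      (S : measurableType d') (P : probability T R) (r : nat)
      (h : r.-tuple S -> R) (X : nat -> T -> S) (i : nat),
      (2 <= r)%N ->
      measurable_fun setT h ->
      symmetric_kernel h ->
      (forall k, measurable_fun setT (X k)) ->
      iid P X ->
      (2 <= i <= r)%N ->
      degenerate_order P h X i.-1 ->
      exp_tail_sup P gamma (first_value h X) = M%:E ->
      forall (x : R) (N : nat), 0 < x -> (r <= N)%N ->
        (P [set w | (N%:R ^+ r * x <
                     \big[Num.max/0]_(r <= n < N.+1) `|Ustat h X n w|)%R] <=
         (K1 * expR (- K2 * N%:R `^ (i%:R * gamma / (2 + i%:R * gamma))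
                          * x `^ (2 * gamma / (2 + i%:R * gamma))))%:E)%E].
Proof.
pose M1 := Num.max 1 (exp_moment_bound M).
have M1_1 : 1 <= M1 by rewrite le_max lexx.
pose D := 4 * expR 384 * M1 * (4 / gamma) `^ (2 / gamma).
have D0 : 0 <= D.
  by rewrite !mulr_ge0 ?powR_ge0 ?expR_ge0// (le_trans ler01).
exists (expR 1), (Num.max 1 (expR 1 * D))^-1; split.
- exact: expR_gt0.
- by rewrite invr_gt0 lt_max ltr01.
move=> d d' T S P r h X i r2 mh h_sym mX X_iid /andP[i2 ir] deg tail x N x0 rN.
have r0 : (0 < r)%N by rewrite ltnW.
have N0 : 0 < N%:R :> R by rewrite ltr0n (leq_trans r0).
have mY : measurable_fun setT (first_value h X).
  apply: measurableT_comp => //; apply/measurable_fun_tnthP => k.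
  rewrite (_ : _ \o _ = X k); first exact: mX.
  by apply/funext => w /=; rewrite tnth_mktuple.
have Ymom := exp_tail_has_moments gamma_gt0 mY tail.
set A := [set w | _].
have mA : measurable A by exact: measurable_max_Ustat.
have PA01 : 0 <= fine (P A) <= 1.
  by rewrite fine_ge0 ?measure_ge0//= -lee_fin fineK ?fin_num_measure// probability_le1.
have [_ [Z Zver Z0] _] := deg.
pose y := N%:R ^+ i * x ^+ 2; pose s : R := i%:R + 2 / gamma.
have y0 : 0 < y by rewrite mulr_gt0 ?exprn_gt0.
have g2 : 0 <= 2 / gamma by rewrite divr_ge0// ltW.
have s1 : 1 <= s.
  by rewrite /s (@le_trans _ _ i%:R) ?lerDl// ler1n ltnW.
rewrite -[P A]fineK ?fin_num_measure// lee_fin.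
have -> : - (Num.max 1 (expR 1 * D))^-1 * N%:R `^ (i%:R * gamma / (2 + i%:R * gamma))
      * x `^ (2 * gamma / (2 + i%:R * gamma)) =
    - (Num.max 1 (expR 1 * D))^-1 * y `^ s^-1.
  have ig : 0 < 2 + i%:R * gamma by rewrite addr_gt0// mulr_gt0// ltr0n ltnW.
  have sE : s^-1 = gamma / (2 + i%:R * gamma).
    rewrite /s; field; rewrite !gt_eqF//.
  rewrite -mulrA; congr (_ * _).
  rewrite /y powRM ?exprn_ge0 ?ltW// -!powR_mulrn ?ltW// -!powRrM sE.
  by congr (_ `^ _ * _ `^ _); ring.
apply: optimize_moment_order => // q q0.
rewrite -lee_fin fineK ?fin_num_measure//.
pose c := M1 * (4 * q%:R / gamma) `^ (2 / gamma).
have c0 : 0 <= c by rewrite mulr_ge0 ?powR_ge0// (le_trans ler01).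
have Yc : \int[P]_w (first_value h X w ^+ q.*2) <= c ^+ q.
  apply: le_trans (exp_tail_Rmoment gamma_gt0 mY tail q0) _.
  rewrite /c exprMn mulrC ler_wpM2r ?exprn_ge0 ?powR_ge0//.
  apply: (@le_trans _ _ M1); first by rewrite le_max lexx orbT.
  by rewrite ler_eXnr.
pose b j := if (j < i)%N then 0 else
  (96 ^+ j / j`!%:R * (N%:R ^+ j.*2 / N%:R ^+ i) * q%:R ^+ i * c) ^+ q.
have Vb j : (j <= r)%N -> \int[P]_w ((\sum_(J : {set 'I_N} | #|J| == j)
    component P X h J w) ^+ q.*2) <= b j.
  move=> jr; rewrite /b; case: ltnP => ij; last exact: homogeneous_moment_le.
  apply: homogeneous_moment_null => // l lj ul.
  have ir' : (i.-1 <= r)%N by rewrite (leq_trans (leq_pred _)).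
  apply: (degenerate_proj_null mX X_iid mh h_sym Ymom ir' Zver Z0) => //.
  by rewrite -ltnS prednK ?(leq_ltn_trans lj)// (leq_trans _ i2).
apply: le_trans (max_Ustat_tail mX X_iid mh h_sym Ymom rN r0 x0 q0 Vb) _.
rewrite lee_fin.
pose Z' := q%:R ^+ i * c / y.
have Z'0 : 0 <= Z'.
  by apply: divr_ge0; [apply: mulr_ge0 => //; exact: exprn_ge0|exact: ltW].
pose a j := 4 * (384 ^+ j / j`!%:R) * Z'.
have a0 j : 0 <= a j.
  by apply: mulr_ge0 => //; apply: mulr_ge0 => //; apply: divr_ge0 => //; exact: exprn_ge0.
apply: (@le_trans _ _ (\sum_(j < r.+1) a j ^+ q)).
  apply: ler_sum => j _; rewrite /b; case: ltnP => ij.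
    by rewrite mul0r exprn_ge0.
  rewrite (expr_dbl (_ / _)) -expr_div_n lerXn2r ?nnegrE//.
    have yq : 0 <= (N%:R ^+ j * x / 2 ^+ j.+1) ^+ 2 :> R by exact: sqr_ge0.
    by apply: divr_ge0 => //; apply: mulr_ge0.
  rewrite le_eqVlt; apply/orP; left; apply/eqP.
  have E : 384 ^+ j = 96 ^+ j * (2 ^+ j * 2 ^+ j) :> R.
    by rewrite -!exprMn -!natrM.
  rewrite /a E /Z' /y -addnn exprD [2 ^+ _.+1]exprS; field.
  by rewrite !gt_eqF ?exprn_gt0// ltr0n fact_gt0.
apply: le_trans (sum_expr_le _ q0 a0) _.
have aD : \sum_(j < r.+1) a j <= D * q%:R `^ s / y.
  rewrite /a -mulr_suml -mulr_sumr.
  apply: (@le_trans _ _ (4 * expR 384 * Z')).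
    by rewrite ler_wpM2r// ler_wpM2l// sum_exp_le.
  rewrite le_eqVlt; apply/orP; left; apply/eqP.
  rewrite /Z' /c /D /s powRD; last first.
    by rewrite pnatr_eq0 (gtn_eqF q0) implybT.
  rewrite powR_mulrn// (_ : 4 * q%:R / gamma = 4 / gamma * q%:R); last by ring.
  by rewrite powRM ?divr_ge0 ?(ltW gamma_gt0)//; ring.
rewrite lerXn2r ?nnegrE ?sumr_ge0//.
by apply: le_trans aD; rewrite sumr_ge0.
Qed.
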